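(* Let $\lambda$ be the intensity of the stationary exponential Hawkes process $N$ with parameter $\theta=(\xi,\alpha,\beta)$ and let $\widehat{\lambda}$ be its plug-in estimator, both as defined in the context. Assume there exists $\varepsilon\in(0,1)$ such that $\beta>\varepsilon$ and $\widehat{\beta}>\varepsilon$. Then for any $q\ge2$ there exists a constant $C>0$, independent of $t$ and $T$, such that for any $t\in[0,T]$, $$\mathbb{E}\big[|\widehat{\lambda}_t-\lambda_t|^q\big]^{1/q}\le\frac{C}{\sqrt{T}}+\mathbb{E}\big[|\lambda_0-\widetilde{\lambda}_0|^q\big]^{1/q}e^{-\varepsilon t}.$$
   Context: Model. $N$ is a one-dimensional càdlàg counting process with jump times $(T_i)_{i\ge1}$ on $(0,\infty)$ and left-continuous predictable intensity $\lambda_t=\xi+(\lambda_0-\xi)e^{-\beta t}+\int_0^{t-}\alpha e^{-\beta(t-u)}\,dN_u$ (so $N_t-\int_0^t\lambda_s ds$ is a local martingale), where $\xi>0$, $\alpha>0$, $\beta>0$ and $\alpha/\beta<1$. Standing assumption: the process is in the stationary regime (in the paper, $(X_0,\lambda_0)$ follows the invariant law of the pair $(X,\lambda)$, where $X$ is a diffusion with jumps driven by $N$); in particular $\lambda_0\ge\xi$ and $\lambda$ is stationary. Estimation of $\theta$. $\widehat{\theta}_T=(\widehat{\xi},\widehat{\alpha},\widehat{\beta})$ is the maximum likelihood estimator of $\theta$ for the exponential Hawkes process, computed from a second dataset observed on a time horizon $T$ which is independent of the first one (hence $\widehat{\theta}_T$ is independent of $N$ and $\lambda$). It is a known result from the literature,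 taken as given, that for any $k\ge1$ there is $C>0$ with $\mathbb{E}[|\widehat{\theta}_T-\theta|^k]\le C\,T^{-k/2}$. Plug-in intensity. For $t\in[0,T]$, $$\widehat{\lambda}_t=\widehat{\xi}+\sum_{T_i<t}\widehat{\alpha}\,e^{-\widehat{\beta}(t-T_i)}+(\widetilde{\lambda}_0-\widehat{\xi})e^{-\widehat{\beta}t},$$ where the random variable $\widetilde{\lambda}_0$ is an approximation of the initial condition $\lambda_0$. *)

(* Defs.v *)
From HB Require Import structures.
From mathcomp Require Import all_boot all_order all_algebra.
From mathcomp Require Import all_classical all_reals all_analysis.
Set Implicit Arguments.
Unset Strict Implicit.
Unset Printing Implicit Defensive.
Import Order.TTheory GRing.Theory Num.Theory.
Import numFieldNormedType.Exports.
Local Open Scope classical_set_scope.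
Local Open Scope ring_scope.

Record hawkes_param (R : Type) := HawkesParam {
  base_rate : R ;   (* xi *)
  jump_size : R ;   (* alpha *)
  decay_rate : R    (* beta *) }.

Section ParamTheory.
Context {R : realType}.
Implicit Types p q : hawkes_param R.

Definition positive_param p : Prop :=
  [/\ 0 < base_rate p, 0 < jump_size p & 0 < decay_rate p].

Definition subcritical p : Prop := jump_size p / decay_rate p < 1.

(* Euclidean distance in R^3 *)
Definition param_dist p q : R :=
  Num.sqrt ((base_rate p - base_rate q) ^+ 2
            + (jump_size p - jump_size q) ^+ 2
            + (decay_rate p - decay_rate q) ^+ 2).

End ParamTheory.

Section Paths.
Context {R : realType}.
Implicit Types (p : hawkes_param R) (T : nat -> R) (t : R).

(* \int_A f dN for the counting measure dN = \sum_i dirac (T i).  This is a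
   finite sum for bounded A, because jump times are assumed to diverge. *)
Definition count_int T (A : set R) (f : R -> R) : R :=
  \sum_(i \in [set i | A (T i)]) f (T i).

Definition counting T t : R := count_int T `]0, t] (fun=> 1).

(* The integral over `]0, t[ (excluding t) makes the intensity left-continuous
   in t, hence predictable once l0 and the counting process are adapted. *)
Definition intensity p T (l0 : R) t : R :=
  base_rate p + (l0 - base_rate p) * expR (- decay_rate p * t)
  + count_int T `]0, t[
      (fun u => jump_size p * expR (- decay_rate p * (t - u))).

Definition compensator p T (l0 : R) t : R :=
  \int[lebesgue_measure]_(s in `[0, t]) intensity p T l0 s.

(* Log-likelihood of a point process path observed on [0, t], for the candidate
   parameter p and the candidate initial intensity l0. *)
Definition log_likelihood p T (l0 : R) t : R :=
  count_int T `]0, t] (fun s => ln (intensity p T l0 s))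
  - compensator p T l0 t.

End Paths.

Section Processes.
Context {d : measure_display} {Omega : measurableType d} {R : realType}.
Context (P : probability Omega R).
Implicit Types (F : R -> set (set Omega)) (G H : set (set Omega)).
Implicit Types (X : Omega -> R) (M : R -> Omega -> R) (S : Omega -> \bar R).

Definition measurable_wrt G X : Prop :=
  forall B : set R, measurable B -> G (X @^-1` B).

Definition independent_families G H : Prop :=
  forall A B, G A -> H B -> P (A `&` B) = (P A * P B)%E.

(* Time ranges over the nonnegative reals; values at negative indices are
   irrelevant. *)
Record filtration F : Prop := Filtration {
  filtration_sigma : forall t, 0 <= t -> sigma_algebra setT (F t) ;
  filtration_sub : forall t, 0 <= t -> F t `<=` measurable ;
  filtration_incr : forall s t, 0 <= s -> s <= t -> F s `<=` F t }.

Definition adapted F M : Prop :=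
  forall t, 0 <= t -> measurable_wrt (F t) (M t).

(* The last clause is E[M t | F s] = M s. *)
Record martingale F M : Prop := Martingale {
  martingale_adapted : adapted F M ;
  martingale_integrable :
    forall t, 0 <= t -> P.-integrable setT (EFin \o M t) ;
  martingale_cond : forall s t A, 0 <= s -> s <= t -> F s A ->
    (\int[P]_(w in A) (M t w)%:E = \int[P]_(w in A) (M s w)%:E)%E }.

Definition stopping_time F S : Prop :=
  (forall w, (0 <= S w)%E) /\
  (forall t, 0 <= t -> F t [set w | (S w <= t%:E)%E]).

Definition stopped S M : R -> Omega -> R :=
  fun t w => M (fine (Order.min t%:E (S w))) w.

Definition local_martingale F M : Prop :=
  exists S : nat -> Omega -> \bar R,
    [/\ forall n, stopping_time F (S n),
        forall n w, (S n w <= S n.+1 w)%E,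
        {ae P, forall w, S n w @[n --> \oo] --> +oo%E}
      & forall n, martingale F (stopped (S n) (fun t w => M t w - M 0 w))].

(* Strict stationarity on [0, +oo[: invariance under time shifts of all
   finite-dimensional distributions. *)
Definition stationary M : Prop :=
  forall (n : nat) (t : 'I_n -> R) (B : 'I_n -> set R) (h : R),
    (forall i, 0 <= t i) -> 0 <= h -> (forall i, measurable (B i)) ->
    P (\bigcap_(i in [set: 'I_n]) (M (t i + h) @^-1` B i))
    = P (\bigcap_(i in [set: 'I_n]) (M (t i) @^-1` B i)).

(* Exponential Hawkes process with parameter p, jump times T i (indexed from 0)
   and initial intensity l0, with respect to the filtration F. *)
Record hawkes F (p : hawkes_param R) (T : nat -> Omega -> R)
    (l0 : Omega -> R) : Prop := Hawkes {
  hawkes_filtration : filtration F ;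
  hawkes_jump_gt0 : forall i w, 0 < T i w ;
  hawkes_jump_incr : forall i w, T i w < T i.+1 w ;
  hawkes_jump_cvg : forall w, T i w @[i --> \oo] --> +oo ;
  hawkes_counting_adapted : adapted F (fun t w => counting (T^~ w) t) ;
  hawkes_init_measurable : measurable_wrt (F 0) l0 ;
  hawkes_local_martingale : local_martingale F
    (fun t w => counting (T^~ w) t - compensator p (T^~ w) (l0 w) t) }.

Record stationary_hawkes F p T l0 : Prop := StationaryHawkes {
  stationary_hawkes_hawkes : hawkes F p T l0 ;
  stationary_hawkes_init_ge : {ae P, forall w, base_rate p <= l0 w} ;
  stationary_hawkes_stationary :
    stationary (fun t w => intensity p (T^~ w) (l0 w) t) }.

(* sigma-algebra generated by the counting process and its intensity at the
   times in D *)
Definition hawkes_sigma (D : set R) (p : hawkes_param R)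
    (T : nat -> Omega -> R) (l0 : Omega -> R) : set (set Omega) :=
  <<s \bigcup_(t in D)
        (preimage_set_system setT (fun w => counting (T^~ w) t) measurable
         `|` preimage_set_system setT
               (fun w => intensity p (T^~ w) (l0 w) t) measurable) >>.

(* Random parameter maximising over Theta the log-likelihood on [0, t].  The
   initial value init q w given to the intensity for a candidate q is left
   free: it may be the true initial intensity, or base_rate q (empty past). *)
Definition is_mle (Theta : set (hawkes_param R))
    (init : hawkes_param R -> Omega -> R) (T : nat -> Omega -> R) (t : R)
    (thetahat : Omega -> hawkes_param R) : Prop :=
  {ae P, forall w, Theta (thetahat w) /\
    forall q, Theta q ->
      log_likelihood q (T^~ w) (init q w) t
      <= log_likelihood (thetahat w) (T^~ w) (init (thetahat w) w) t}.

Definition param_measurable_wrt G (thetahat : Omega -> hawkes_param R) : Prop :=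
  [/\ measurable_wrt G (fun w => base_rate (thetahat w)),
      measurable_wrt G (fun w => jump_size (thetahat w))
    & measurable_wrt G (fun w => decay_rate (thetahat w))].

End Processes.

(* Main.v *)
Require Import Defs.
From HB Require Import structures.
From mathcomp Require Import all_boot all_order all_algebra.
From mathcomp Require Import finmap ring lra.
From mathcomp Require Import all_classical all_reals all_analysis measurable_realfun.
Set Implicit Arguments.
Unset Strict Implicit.
Unset Printing Implicit Defensive.
Import Order.TTheory GRing.Theory Num.Theory.
Import numFieldNormedType.Exports.
Local Open Scope classical_set_scope.
Local Open Scope ring_scope.

(** Write [lambda] for the true intensity and [lambdahat] for its plug-in
    version. The two paths share their jump times, so their difference at time
    [t] splits into the initial error, discounted by [e^{-eps t}], and terms
    that are each bounded by the parameter error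
    [param_dist thetahat theta] times a functional of the first dataset:
    [|e^{-x u} - e^{-y u}| <= |x - y| u e^{-eps u}], and half of the exponential
    absorbs the factor [u]. The functional is affine in [lambda_0] and in the
    discounted number of jumps [sum e^{-(eps/2)(t - T_i)}] ([plug_in_error]).
    Minkowski's inequality isolates the initial error with constant one, and
    independence of the two datasets factorizes the norm of the remaining
    product ([normqM_indep]). The parameter error has norm of order
    [T^{-1/2}], by interpolation from an integer moment ([normq_le_moment]).
    A jump that is at most one unit of time old still weighs
    [alpha e^{-beta}] in the intensity, so the discounted number of jumps is
    dominated by a geometric sum of the stationary variables
    [lambda_t, lambda_{t-1}, ...] ([discounted_jumps_le_sampled]), and
    everything rests on [lambda_0] having finite moments of every order.

    Finite moments are not assumed and come from stationarity and the local
    martingale property. Integrating the dynamics along a path gives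
    [lambda_t = lambda_0 + beta xi t + alpha N_{t-} - beta Lambda_t] with
    [Lambda] the compensator. Hence, for [a = c alpha],
    [c lambda_t <= c lambda_0 + c beta xi t + (a N_t - (e^a - 1) Lambda_t)
    - (c beta - (e^a - 1)) Lambda_t]. The exponential of the bracket is a
    supermartingale ([exp_supermartingale]). By subcriticality
    [alpha < beta], the last coefficient is positive for small [c], and
    [Lambda_1] is at least a fixed multiple of [lambda_0]. So [e^{c lambda_1}]
    has conditional expectation at most [e^{c lambda_0} / 2 + K] given the
    past. As [lambda_1] and [lambda_0] have the same law, comparing truncated
    expectations gives a finite exponential moment ([exp_moment]).

    The supermartingale property is proved on a grid of mesh [dlt]. Over one
    step, [e^{a N - (e^a - 1) Lambda}] is multiplied by at most one plus a
    multiple of the martingale increment, plus [O(dlt^2)], plus a penalty when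
    the step has two jumps or more. The number of such steps is bounded and
    vanishes as the mesh tends to zero ([double_jumps_cvg]). Killing the
    functional at a localizing stopping time and after a fixed number of jumps
    makes all terms integrable. *)

(** * Counting paths and their compensators *)

Section JumpPath.
Context {R : realType}.
Implicit Types (T : nat -> R) (p : hawkes_param R).

Record jump_path T : Prop := JumpPath {
  jump_path_gt0 : forall i, 0 < T i ;
  jump_path_incr : forall i, T i < T i.+1 ;
  jump_path_cvg : T i @[i --> \oo] --> +oo }.

Variable T : nat -> R.
Hypothesis hT : jump_path T.

Lemma jump_path_homo : {homo T : i j / (i < j)%N >-> i < j}.
Proof.
apply: homo_ltn => [y x z|i]; first exact: lt_trans.
exact: jump_path_incr.
Qed.

Lemma jump_path_mono : {mono T : i j / (i <= j)%N >-> i <= j}.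
Proof. exact: le_mono jump_path_homo. Qed.

Lemma jump_path_late (t : R) : exists n, forall i, (n <= i)%N -> t < T i.
Proof.
have [n _ Hn] := (cvgryPgt _).1 (jump_path_cvg hT) t.
by exists n => i ni; exact: Hn.
Qed.

(** Jump times increase to infinity, so the jumps up to a given time are those
    of index below some [n]: every integral against the counting process
    becomes an ordinary finite sum. *)
Lemma jumps_le (t : R) : exists n, forall i, (T i <= t) = (i < n)%N.
Proof.
have /cid[n hn] := jump_path_late t.
have ex : exists n, t < T n by exists n; exact: hn.
exists (ex_minn ex) => i; case: ex_minnP => m tm mmin.
apply/idP/idP => [ti|im].
  by rewrite ltnNge -jump_path_mono -ltNge (le_lt_trans ti).
by rewrite leNgt; apply/negP => /mmin; rewrite leqNgt im.
Qed.

Lemma jumps_lt (t : R) : exists n, forall i, (T i < t) = (i < n)%N.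
Proof.
have /cid[n hn] := jump_path_late t.
have ex : exists n, t <= T n by exists n; exact: (ltW (hn _ _)).
exists (ex_minn ex) => i; case: ex_minnP => m tm mmin.
apply/idP/idP => [ti|im].
  by rewrite ltnNge -jump_path_mono -ltNge (lt_le_trans ti).
by rewrite ltNge; apply/negP => /mmin; rewrite leqNgt im.
Qed.

Lemma count_int_sum (A : set R) (f : R -> R) (a : pred R) n :
    (forall i, A (T i) <-> a (T i)) ->
    (forall i, (n <= i)%N -> ~~ a (T i)) ->
  count_int T A f = \sum_(i < n) (if a (T i) then f (T i) else 0).
Proof.
move=> aA an; rewrite /count_int fsbig_mkcond/=.
rewrite -(fsbig_widen `I_n setT)/=.
- rewrite -fsbig_ord; apply: eq_bigr => i _.
  rewrite patchE; have [aT|aT] := boolP (a (T i)).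
    by rewrite mem_set//; exact/aA.
  by rewrite memNset//= => /aA; rewrite (negbTE aT).
- by [].
- move=> i [_ /=] /negP; rewrite -leqNgt => /an /negP H.
  by rewrite patchE memNset//= => /aA.
Qed.

Lemma count_int_oo (t : R) (f : R -> R) n :
    (forall i, (n <= i)%N -> t <= T i) ->
  count_int T `]0, t[ f = \sum_(i < n) (if T i < t then f (T i) else 0).
Proof.
move=> H; apply: (@count_int_sum _ f (fun u => u < t)).
  by move=> i; rewrite /= in_itv/= jump_path_gt0.
by move=> i /H; rewrite leNgt.
Qed.

Lemma count_int_oc (t : R) (f : R -> R) n :
    (forall i, (n <= i)%N -> t < T i) ->
  count_int T `]0, t] f = \sum_(i < n) (if T i <= t then f (T i) else 0).
Proof.
move=> H; apply: (@count_int_sum _ f (fun u => u <= t)).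
  by move=> i; rewrite /= in_itv/= jump_path_gt0.
by move=> i /H; rewrite ltNge.
Qed.

Lemma countingE (t : R) n : (forall i, (T i <= t) = (i < n)%N) ->
  Defs.counting T t = n%:R.
Proof.
move=> H; rewrite /Defs.counting (@count_int_oc t _ n).
  rewrite (eq_bigr (fun=> 1)) ?sumr_const ?card_ord// => i _.
  by rewrite H ltn_ord.
by move=> i; rewrite ltNge H -leqNgt.
Qed.

Lemma counting_leP (t : R) i : (T i <= t) = (i.+1%:R <= Defs.counting T t).
Proof. by have [n H] := jumps_le t; rewrite (countingE H) ler_nat H. Qed.

Lemma counting_nat (t : R) : exists n, Defs.counting T t = n%:R.
Proof. by have [n H] := jumps_le t; exists n; rewrite (countingE H). Qed.

Lemma counting_le (s t : R) : s <= t -> Defs.counting T s <= Defs.counting T t.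
Proof.
move=> st; have [[m Hm] [n Hn]] := (jumps_le s, jumps_le t).
rewrite (countingE Hm) (countingE Hn) ler_nat leqNgt; apply/negP => nm.
have : T n <= s by rewrite Hm.
by move=> /le_trans/(_ st); rewrite Hn ltnn.
Qed.

Lemma counting0 (t : R) : t <= 0 -> Defs.counting T t = 0.
Proof.
move=> t0; rewrite (@countingE t 0)// => i.
by rewrite ltn0; apply/negbTE; rewrite -ltNge (le_lt_trans t0)// jump_path_gt0.
Qed.

End JumpPath.

Section Relaxation.
Context {R : realType}.
Variable beta : R.
Hypothesis beta_gt0 : 0 < beta.

(** The integral of [e^{-beta s}] over [s] in [[0, u]], extended by zero to
    negative [u]: sums over jumps need not know which jumps have occurred. *)
Definition relax (u : R) : R := (1 - expR (- beta * Num.max u 0)) / beta.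

Lemma relax0 (u : R) : u <= 0 -> relax u = 0.
Proof. by move=> u0; rewrite /relax max_r// mulr0 expR0 subrr mul0r. Qed.

Lemma relaxE (u : R) : 0 <= u -> expR (- beta * u) = 1 - beta * relax u.
Proof. by move=> u0; rewrite /relax max_l// mulrCA divff ?gt_eqF// mulr1 subKr. Qed.

Lemma relax_nd : {homo relax : u v / u <= v}.
Proof.
move=> u v uv; rewrite /relax ler_pM2r ?invr_gt0// lerB// ler_expR.
by rewrite !mulNr lerN2 ler_pM2l// ge_max !le_max uv lexx orbT.
Qed.

Lemma relax_ge0 (u : R) : 0 <= relax u.
Proof.
by rewrite -(relax0 (u := Num.min u 0)) ?relax_nd// ge_min lexx// orbT.
Qed.

Lemma relax_lip (u v : R) : u <= v -> relax v - relax u <= v - u.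
Proof.
move=> uv; rewrite /relax -mulrBl ler_pdivrMr//.
set x := Num.max u 0; set y := Num.max v 0.
rewrite (_ : _ - _ - _ = expR (- beta * x) - expR (- beta * y)); last by ring.
have xy : 0 <= y - x <= v - u.
  by rewrite /x /y; case: (lerP u 0) => ?; case: (lerP v 0) => ?; lra.
have x0 : 0 <= x by rewrite /x le_max lexx orbT.
have /andP[xy0 xyl] := xy.
have -> : - beta * y = - beta * x + - beta * (y - x) by ring.
rewrite expRD -{1}[expR (- beta * x)]mulr1 -mulrBr.
have h : 1 - expR (- beta * (y - x)) <= (v - u) * beta.
  have h' : (y - x) * beta <= (v - u) * beta by rewrite ler_pM2r.
  by have := expR_ge1Dx (- beta * (y - x)); lra.
have h0 : 0 <= 1 - expR (- beta * (y - x)).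
  by rewrite subr_ge0 expR_le1 mulNr oppr_le0 mulr_ge0// ltW.
apply: le_trans h; rewrite ler_piMl// expR_le1 mulNr oppr_le0.
by rewrite mulr_ge0// ltW.
Qed.

Lemma relax_gt0 (u : R) : 0 < u -> 0 < relax u.
Proof.
move=> u0; rewrite /relax divr_gt0// subr_gt0 expR_lt1 max_l ?ltW//.
by rewrite mulNr oppr_lt0 mulr_gt0.
Qed.

Let mu := @lebesgue_measure R.

Lemma continuous_decay (c : R) :
  continuous (fun s : R => expR (- beta * (s - c)) : R^o).
Proof.
move=> x; apply: (@continuous_comp _ _ _ (fun s : R => - beta * (s - c)) expR).
  by apply: cvgM; [exact: cvg_cst|apply: cvgB; [exact: cvg_id|exact: cvg_cst]].
exact: continuous_expR.
Qed.

Lemma integrable_decay (a b c : R) :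
  mu.-integrable `[a, b] (EFin \o (fun s => expR (- beta * (s - c)))).
Proof.
apply: continuous_compact_integrable; first exact: segment_compact.
exact/continuous_subspaceT/continuous_decay.
Qed.

Lemma integral_decay (a b : R) : a <= b ->
  \int[mu]_(s in `[a, b]) expR (- beta * (s - a)) = relax (b - a).
Proof.
rewrite le_eqVlt => /predU1P[<-|ab].
  by rewrite set_itv1 Rintegral_set1 subrr relax0.
pose F (s : R) : R := - (expR (- beta * (s - a)) / beta).
have dF (x : R) : is_derive x 1 F (expR (- beta * (x - a))).
  rewrite /F; apply: is_derive_eq.
  by rewrite /GRing.scale/=; field; rewrite gt_eqF.
rewrite /Rintegral (continuous_FTC2 (F := F) ab).
- rewrite /= /F subrr mulr0 expR0 /relax max_l ?subr_ge0 ?ltW//; field.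
  by rewrite gt_eqF.
- exact/continuous_subspaceT/continuous_decay.
- have cF (x : R) : F y @[y --> x] --> F x.
    by apply/differentiable_continuous/derivable1_diffP; case: (dF x).
  split.
  + by move=> x _; case: (dF x).
  + exact: cvg_at_right_filter.
  + exact: cvg_at_left_filter.
- by move=> x _; rewrite derive1E; apply: derive_val.
Qed.

End Relaxation.

Section RealIntegrability.
Context d {X : measurableType d} {R : realType} (m : {measure set X -> \bar R}).
Variable D : set X.
Hypothesis mD : measurable D.

Lemma integrable_EFinD (f g : X -> R) : m.-integrable D (EFin \o f) ->
  m.-integrable D (EFin \o g) -> m.-integrable D (EFin \o (fun x => f x + g x)).
Proof. by move=> hf hg; exact: (integrableD mD hf hg). Qed.

Lemma integrable_EFinZ (k : R) (f : X -> R) : m.-integrable D (EFin \o f) ->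
  m.-integrable D (EFin \o (fun x => k * f x)).
Proof. by move=> hf; exact: (integrableZl mD k hf). Qed.

End RealIntegrability.

Section HawkesPath.
Context {R : realType}.
Variables (p : hawkes_param R) (T : nat -> R) (l0 : R).
Hypothesis hT : jump_path T.
Let xi := base_rate p.
Let alpha := jump_size p.
Let beta := decay_rate p.
Hypothesis beta_gt0 : 0 < beta.
Let mu := @lebesgue_measure R.

Let step (c s : R) : R := if c < s then expR (- beta * (s - c)) else 0.

Let stepP (c t : R) : 0 < c ->
  mu.-integrable `[0, t] (EFin \o step c) /\
  \int[mu]_(s in `[0, t]) step c s = relax beta (t - c).
Proof.
move=> c0; pose g (s : R) := expR (- beta * (s - c)).
have E : {in `[0, t]%classic, g \_ `]c, t]%classic =1 step c}.
  move=> s; rewrite inE/= in_itv/= => /andP[s0 st]; rewrite patchE /step.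
  case: ifPn => [|]; rewrite ?(inE, notin_setE)/= in_itv/= st andbT.
    by move=> ->.
  by move=> /negP/negbTE ->.
have sub : `[0, t] `&` `]c, t] = `]c, t]%classic.
  apply/seteqP; split => [s []//|s /=]; rewrite !in_itv/= => /andP[cs st].
  by rewrite st cs (ltW (lt_trans c0 cs)).
have ig : mu.-integrable `]c, t] (EFin \o g).
  apply: (@integrableS _ _ _ mu `[c, t]) => //; last exact: integrable_decay.
  exact: subset_itv_oc_cc.
split.
  apply: (@eq_integrable _ _ _ mu _ _ (EFin \o (g \_ `]c, t]%classic))) => //.
    by move=> s /E /= ->.
  by rewrite -restrict_EFin; apply/integrable_restrict; rewrite ?sub.
rewrite (_ : \int[mu]_(s in `[0, t]) step c s =
    \int[mu]_(s in `[0, t]) (g \_ `]c, t]%classic) s); last first.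
  by apply: eq_Rintegral => s si; rewrite E.
rewrite -Rintegral_mkcondr sub.
have [tc|ct] := leP t c.
  by rewrite set_itv_ge ?bnd_simp -?leNgt// Rintegral_set0 relax0// subr_le0.
rewrite Rintegral_itv_obnd_cbnd// integral_decay// ltW//.
Qed.

(** On [[0, t]] only finitely many jumps contribute and each exponential
    integrates to [relax]; bounds on the compensator then reduce to bounds on
    [relax], and its adaptedness to that of the jump times. *)
Lemma compensatorE (t : R) n : 0 <= t -> (forall i, (n <= i)%N -> t <= T i) ->
  compensator p T l0 t = xi * t + (l0 - xi) * relax beta t
                         + alpha * \sum_(i < n) relax beta (t - T i).
Proof.
move=> t0 H.
have E : {in `[0, t]%classic, intensity p T l0 =1 fun s =>
    xi + (l0 - xi) * expR (- beta * (s - 0)) + \sum_(i < n) alpha * step (T i) s}.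
  move=> s; rewrite inE/= in_itv/= => /andP[s0 st].
  rewrite /intensity (@count_int_oo _ _ hT s _ n); last first.
    by move=> i /H; exact: le_trans.
  rewrite subr0; congr (_ + _); apply: eq_bigr => i _.
  by rewrite /step; case: ifP => // _; rewrite mulr0.
have i0 : mu.-integrable `[0, t] (EFin \o cst xi).
  by apply: continuous_compact_integrable;
    [exact: segment_compact|exact/continuous_subspaceT/cst_continuous].
have i1' := integrable_decay beta 0 t 0.
have i1 : mu.-integrable `[0, t]
    (EFin \o fun s => (l0 - xi) * expR (- beta * (s - 0))).
  exact: integrable_EFinZ.
have i01 : mu.-integrable `[0, t]
    (EFin \o fun s => xi + (l0 - xi) * expR (- beta * (s - 0))).
  exact: integrable_EFinD.
have ist k : mu.-integrable `[0, t] (EFin \o fun s => \sum_(i < k) alpha * step (T i) s).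
  elim: k => [|k IH].
    under [X in _ \o X]eq_fun do rewrite big_ord0.
    exact: integrable0.
  under [X in _ \o X]eq_fun do rewrite big_ord_recr/=.
  have [ik _] := stepP t (jump_path_gt0 hT k).
  by apply: integrable_EFinD => //; exact: integrable_EFinZ.
have vs k : \int[mu]_(s in `[0, t]) (\sum_(i < k) alpha * step (T i) s)
    = alpha * \sum_(i < k) relax beta (t - T i).
  elim: k => [|k IH].
    under eq_Rintegral do rewrite big_ord0.
    by rewrite big_ord0 mulr0 Rintegral_cst// mul0r.
  under eq_Rintegral do rewrite big_ord_recr/=.
  have [ik vk] := stepP t (jump_path_gt0 hT k).
  rewrite RintegralD//; [|exact: ist|exact: integrable_EFinZ].
  by rewrite IH RintegralZl// vk big_ord_recr/= mulrDr.
rewrite (_ : compensator p T l0 t = \int[mu]_(s in `[0, t])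
    (xi + (l0 - xi) * expR (- beta * (s - 0))
     + \sum_(i < n) alpha * step (T i) s)); last first.
  by apply: eq_Rintegral => s si; rewrite E.
rewrite RintegralD// RintegralD//.
rewrite vs Rintegral_cst// RintegralZl// integral_decay// subr0.
have lebt : fine (mu `[0, t]) = t.
  rewrite /mu (lebesgue_measure_itv `[0, t])/= lte_fin.
  by move: t0; rewrite le_eqVlt => /predU1P[<-|->]; rewrite ?ltxx//= subr0.
by rewrite lebt.
Qed.

(** Integrating [d lambda = beta (xi - lambda) dt + alpha dN] along a path.
    The left-continuous intensity sees only the jumps strictly before [t]. *)
Lemma intensity_compensator (t : R) n : 0 <= t ->
    (forall i, (T i < t) = (i < n)%N) ->
  intensity p T l0 t
  = l0 + beta * xi * t + alpha * n%:R - beta * compensator p T l0 t.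
Proof.
move=> t0 H.
have Hn i : (n <= i)%N -> t <= T i by rewrite leqNgt leNgt H.
rewrite (compensatorE t0 Hn) /intensity (count_int_oo hT _ Hn).
rewrite relaxE//.
have -> : \sum_(i < n) (if T i < t then alpha * expR (- beta * (t - T i)) else 0)
    = alpha * n%:R - beta * (alpha * \sum_(i < n) relax beta (t - T i)).
  rewrite mulrCA -mulrBr -[n in n%:R]card_ord -sumr_const mulr_sumr -sumrB mulr_sumr.
  apply: eq_bigr => i _; rewrite H ltn_ord relaxE// subr_ge0 ltW//.
  by rewrite H ltn_ord.
by rewrite -/xi -/beta; ring.
Qed.

Lemma compensator0 : compensator p T l0 0 = 0.
Proof.
rewrite (@compensatorE 0 0)//; last by move=> i _; rewrite ltW// jump_path_gt0.
by rewrite big_ord0 !mulr0 relax0// mulr0 !addr0.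
Qed.

Hypothesis xi_le : xi <= l0.
Hypothesis alpha_ge0 : 0 <= alpha.

Lemma compensator_le (s t : R) : 0 <= xi -> 0 <= s -> s <= t ->
  compensator p T l0 s <= compensator p T l0 t.
Proof.
move=> xi0 s0 st; have [n H] := jump_path_late hT t.
have Ht i : (n <= i)%N -> t <= T i by move=> /H/ltW.
have Hs i : (n <= i)%N -> s <= T i by move=> /Ht; exact: le_trans.
rewrite (compensatorE s0 Hs) (compensatorE (le_trans s0 st) Ht).
rewrite lerD//; first rewrite lerD//.
- exact: ler_wpM2l.
- by rewrite ler_wpM2l ?subr_ge0// relax_nd.
- by rewrite ler_wpM2l// ler_sum// => i _; rewrite relax_nd// lerD2r.
Qed.

(** Between [s] and [t] the intensity never exceeds [l0 + alpha N_t]. *)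
Lemma compensator_lip (s t : R) : 0 <= xi -> 0 <= s -> s <= t ->
  compensator p T l0 t - compensator p T l0 s
  <= (t - s) * (l0 + alpha * Defs.counting T t).
Proof.
move=> xi0 s0 st; have [n H] := jumps_le hT t.
have Ht i : (n <= i)%N -> t <= T i by rewrite leqNgt -H -ltNge => /ltW.
have Hs i : (n <= i)%N -> s <= T i by move=> /Ht; exact: le_trans.
rewrite (compensatorE s0 Hs) (compensatorE (le_trans s0 st) Ht).
rewrite (countingE hT H).
have h1 : (l0 - xi) * (relax beta t - relax beta s) <= (l0 - xi) * (t - s).
  by rewrite ler_wpM2l ?subr_ge0// relax_lip.
have h2 : \sum_(i < n) relax beta (t - T i) - \sum_(i < n) relax beta (s - T i)
    <= (t - s) * n%:R.
  rewrite -sumrB -[n in n%:R]card_ord -sumr_const mulr_sumr ler_sum// => i _.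
  rewrite mulr1 (le_trans (relax_lip _ _))//; first by rewrite lerD2r.
  by rewrite opprB addrA subrK.
have := ler_wpM2l alpha_ge0 h2; rewrite mulrBr; nra.
Qed.

(** Even without jumps the intensity stays above [l0 e^{-beta s}]. *)
Lemma compensator_ge (t : R) : 0 <= xi -> 0 <= t ->
  l0 * relax beta t <= compensator p T l0 t.
Proof.
move=> xi0 t0; have [n H] := jump_path_late hT t.
have Ht i : (n <= i)%N -> t <= T i by move=> /H/ltW.
rewrite (compensatorE t0 Ht).
have h1 : relax beta t <= t.
  by have := relax_lip beta_gt0 t0; rewrite (relax0 _ (lexx 0)) !subr0.
have h2 : 0 <= alpha * \sum_(i < n) relax beta (t - T i).
  by rewrite mulr_ge0// sumr_ge0// => i _; rewrite relax_ge0.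
have := ler_wpM2l xi0 h1; nra.
Qed.

(** A jump of age at most one still contributes [alpha e^{-beta}] at least to
    the intensity, whereas the older ones are discounted by [e^{-gamma}]. *)
Lemma discounted_jumps_le (gamma t : R) : 0 < alpha -> 0 <= xi -> 0 <= gamma ->
    0 <= t ->
  count_int T `]0, t[ (fun u => expR (- gamma * (t - u)))
  <= expR beta / alpha * intensity p T l0 t
     + expR (- gamma)
       * count_int T `]0, t - 1[ (fun u => expR (- gamma * (t - 1 - u))).
Proof.
move=> alpha_gt0 xi0 g0 t0; have [n H] := jump_path_late hT t.
have Ht i : (n <= i)%N -> t <= T i by move=> /H/ltW.
have Ht' i : (n <= i)%N -> t - 1 <= T i.
  by move=> /Ht; apply: le_trans; rewrite gerBl.
rewrite /intensity !(count_int_oo hT _ Ht) (count_int_oo hT _ Ht').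
apply: (@le_trans _ _ (expR beta / alpha *
    \sum_(i < n) (if T i < t then alpha * expR (- beta * (t - T i)) else 0) +
    expR (- gamma) *
    \sum_(i < n) (if T i < t - 1 then expR (- gamma * (t - 1 - T i)) else 0))).
  rewrite !mulr_sumr -big_split/= ler_sum// => i _.
  have [Tt|tT] := ltP (T i) t; last first.
    rewrite mulr0 add0r; apply: mulr_ge0; first exact: expR_ge0.
    by case: ifP => _ //; exact: expR_ge0.
  rewrite mulrA divfK ?gt_eqF// -expRD.
  have [Tt1|tT1] := ltP (T i) (t - 1).
    rewrite -expRD; apply: (@le_trans _ _ (0 + expR (- gamma * (t - T i)))).
      by rewrite add0r.
    rewrite lerD ?expR_ge0// ler_expR; lra.
  rewrite mulr0 addr0 ler_expR.
  apply: (@le_trans _ _ 0); first by rewrite mulNr oppr_le0 mulr_ge0// subr_ge0 ltW.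
  by rewrite mulNr subr_ge0 -{2}[beta]mulr1 ler_pM2l//; lra.
rewrite lerD2r ler_wpM2l//; first by rewrite divr_ge0// expR_ge0.
rewrite lerDr; apply: addr_ge0 => //; apply: mulr_ge0; first by rewrite subr_ge0.
exact: expR_ge0.
Qed.

End HawkesPath.

(** * Sub-sigma-algebras, laws and independence *)

Section SubSigmaAlgebra.
Context {d : measure_display} {Omega : measurableType d} {R : realType}.
Variable G : set (set Omega).
Hypothesis sG : sigma_algebra setT G.

Lemma measurable_wrtP (X : Omega -> R) :
  measurable_wrt G X <->
  measurable_fun setT (X : g_sigma_algebraType G -> R).
Proof.
have GE (B : set Omega) : measurable (B : set (g_sigma_algebraType G)) = G B.
  by rewrite /measurable/= (sigma_algebra_id sG).
split=> [h _ B mB|h B mB].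
  by rewrite setTI GE; exact: h.
by have := h measurableT _ mB; rewrite setTI GE.
Qed.

Hypothesis subG : G `<=` measurable.

Lemma measurable_wrt_fun (X : Omega -> R) :
  measurable_wrt G X -> measurable_fun setT X.
Proof. by move=> h _ B mB; rewrite setTI; exact/subG/h. Qed.

Variable P : probability Omega R.
Import HBNNSimple.

(** Simple approximations of the weight reduce the claim to indicators, for
    which it is the hypothesis; the bound on the weight keeps the products
    dominated by a multiple of [D]. *)
Lemma integral_wrtM0 (Y D : Omega -> R) (C : R) :
    measurable_wrt G Y -> (forall w, 0 <= Y w <= C) ->
    P.-integrable setT (EFin \o D) ->
    (forall B, G B -> \int[P]_(w in B) (D w)%:E = 0)%E ->
  P.-integrable setT (EFin \o (fun w => Y w * D w)) /\
  (\int[P]_w (Y w * D w)%:E = 0)%E.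
Proof.
move=> mY bY iD h0.
have GE (B : set Omega) : measurable (B : set (g_sigma_algebraType G)) = G B.
  by rewrite /measurable/= (sigma_algebra_id sG).
have mYG : @measurable_fun _ _ (g_sigma_algebraType G) (\bar R) setT (EFin \o Y).
  by apply/measurable_EFinP; exact/measurable_wrtP.
pose g := nnsfun_approx measurableT mYG.
have Y0 : forall x : g_sigma_algebraType G, setT x -> (0 <= (EFin \o Y) x)%E.
  by move=> x _; rewrite /= lee_fin; case/andP: (bY x).
have gY n w : 0 <= g n w <= C.
  rewrite fun_ge0/= /g nnsfun_approxE.
  have := @le_approx _ _ _ setT _ n w Y0 I.
  by rewrite /= lee_fin => /le_trans; apply; case/andP: (bY w).
have mD : measurable_fun setT D by apply/measurable_EFinP; case/integrableP: iD.
have mgG n : measurable_wrt G (g n).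
  apply/measurable_wrtP; exact: measurable_funP.
have mg n : measurable_fun setT (g n : Omega -> R) by exact: measurable_wrt_fun.
have bnd (Z : Omega -> R) : measurable_fun setT Z -> (forall w, 0 <= Z w <= C) ->
    P.-integrable setT (EFin \o (fun w => Z w * D w)).
  move=> mZ bZ.
  apply: (@le_integrable _ _ _ P setT measurableT _ (fun w => C%:E * (EFin \o D) w)%E).
  - by apply/measurable_EFinP; exact: measurable_funM.
  - move=> w _ /=; rewrite lee_fin !normrM ler_wpM2r//.
    have /andP[z0 zC] := bZ w.
    by rewrite !ger0_norm// (le_trans z0).
  - exact: integrableZl.
have iB (a : R) B : G B ->
    P.-integrable setT (fun w => a%:E * ((EFin \o D) \_ B) w)%E /\
    (\int[P]_w (a%:E * ((EFin \o D) \_ B) w) = 0)%E.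
  move=> GB; have mB : measurable B by exact: subG.
  have i1 : P.-integrable setT ((EFin \o D) \_ B).
    by apply/integrable_restrict => //; rewrite setTI; exact: (integrableS measurableT).
  by split; [exact: integrableZl|rewrite integralZl// -integral_mkcond h0// mule0].
have g0 n : (\int[P]_w (g n w * D w)%:E = 0)%E.
  pose s := fset_set ([set g n x | x in setT]).
  have E w : (g n w * D w)%:E = (\sum_(i < #|`s|)
      (s`_i)%:E * ((EFin \o D) \_ (g n @^-1` [set s`_i])) w)%E.
    rewrite fimfunEord mulr_suml -sumEFin; apply: eq_bigr => i _.
    rewrite indicE patchE; case: ifPn => _.
      by rewrite mulr1 EFinM.
    by rewrite mulr0 mul0r mule0.
  have GB (a : R) : G (g n @^-1` [set a]) by apply: mgG; exact: measurable_set1.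
  under eq_integral do rewrite E.
  rewrite integral_sum//; last by move=> i; have [] := iB s`_i _ (GB s`_i).
  by apply: big1 => i _; have [] := iB s`_i _ (GB s`_i).
split; first by apply: bnd => //; exact/measurable_wrt_fun.
have [] := @dominated_convergence _ _ _ P setT measurableT
  (fun n w => (g n w * D w)%:E) (fun w => (Y w * D w)%:E)
  (fun w => C%:E * `|(D w)%:E|)%E.
- by move=> n; apply/measurable_EFinP; exact: measurable_funM.
- by apply/measurable_EFinP; apply: measurable_funM => //; exact: measurable_wrt_fun.
- apply: aeW => w _; apply/fine_cvgP; split; first exact: nearW.
  apply: cvgMl; have := @cvg_nnsfun_approx _ _ _ setT measurableT _ mYG Y0 w I.
  by move/fine_cvgP => [_].
- by apply: integrableZl => //; exact: integrable_abse.
- apply: aeW => w n _; rewrite /= lee_fin normrM ler_wpM2r//.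
  by have /andP[z0 zC] := gY n w; rewrite ger0_norm.
move=> _ _; under eq_fun do rewrite g0.
by move=> /(cvg_lim (@ereal_hausdorff _)) <-; rewrite lim_cst.
Qed.

End SubSigmaAlgebra.

Section Laws.
Context {d : measure_display} {Omega : measurableType d} {R : realType}.
Variable P : probability Omega R.
Local Open Scope ereal_scope.

Lemma integral_same_law (X Y : Omega -> R) (f : R -> \bar R) :
    measurable_fun setT X -> measurable_fun setT Y ->
    (forall B, measurable B -> P (X @^-1` B) = P (Y @^-1` B)) ->
    measurable_fun setT f -> (forall x, 0 <= f x) ->
  \int[P]_w f (X w) = \int[P]_w f (Y w).
Proof.
move=> mX mY XY mf f0.
pose X' : {RV P >-> R} := HB.pack X (isMeasurableFun.Build _ _ _ _ _ mX).
pose Y' : {RV P >-> R} := HB.pack Y (isMeasurableFun.Build _ _ _ _ _ mY).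
rewrite -[LHS](ge0_integral_distribution X')// -[RHS](ge0_integral_distribution Y')//.
by apply: eq_measure_integral => B mB _; exact: XY.
Qed.

Variables G H : set (set Omega).
Hypotheses (subG : G `<=` measurable) (subH : H `<=` measurable).
Hypothesis GH : independent_families P G H.

(** Independence says that the joint law of [(X, Y)] is a product measure. *)
Lemma expectationM_indep (X Y : Omega -> R) :
    measurable_wrt G X -> measurable_wrt H Y ->
    (forall w, (0 <= X w)%R) -> (forall w, (0 <= Y w)%R) ->
  \int[P]_w (X w * Y w)%:E = \int[P]_w (X w)%:E * \int[P]_w (Y w)%:E.
Proof.
move=> GX HY X0 Y0.
have mX : measurable_fun setT X by move=> _ B mB; rewrite setTI; exact/subG/GX.
have mY : measurable_fun setT Y by move=> _ B mB; rewrite setTI; exact/subH/HY.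
pose X' : {RV P >-> R} := HB.pack X (isMeasurableFun.Build _ _ _ _ _ mX).
pose Y' : {RV P >-> R} := HB.pack Y (isMeasurableFun.Build _ _ _ _ _ mY).
have mXY : measurable_fun setT (fun w => (X w, Y w)) by exact: measurable_fun_pair.
pose XY : {RV P >-> (R * R)%type} := HB.pack (fun w => (X w, Y w))
  (isMeasurableFun.Build _ _ _ _ _ mXY).
pose f (z : R * R) : \bar R := (Num.max z.1 0 * Num.max z.2 0)%R%:E.
have mmax : measurable_fun setT (fun x : R => Num.max x 0)%R.
  by apply: measurable_maxr => //; exact: measurable_id.
have mf : measurable_fun setT f.
  apply/measurable_EFinP; apply: measurable_funM.
    exact: (measurableT_comp mmax measurable_fst).
  exact: (measurableT_comp mmax measurable_snd).
have f0 z : 0 <= f z by rewrite lee_fin mulr_ge0// le_max lexx orbT.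
transitivity (\int[distribution P XY]_z f z).
  rewrite ge0_integral_distribution//; apply: eq_integral => w _ /=.
  by rewrite /f/= !max_l.
transitivity (\int[distribution P X' \x distribution P Y']_z f z).
  apply: eq_measure_integral => B mB _; apply/esym.
  apply: product_measure_unique => // A1 A2 mA1 mA2.
  rewrite /= /distribution /pushforward/= -GH; [|exact: GX|exact: HY].
  by congr (P _); apply/seteqP; split => w.
rewrite fubini_tonelli1//.
have E (Z : {RV P >-> R}) : (forall w, 0 <= Z w)%R ->
    \int[P]_w (Z w)%:E = \int[distribution P Z]_x (Num.max x 0)%R%:E.
  move=> Z0; rewrite ge0_integral_distribution//.
  - by apply: eq_integral => w _ /=; rewrite max_l.
  - exact/measurable_EFinP.
  - by move=> x; rewrite lee_fin le_max lexx orbT.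
rewrite (E X' X0) (E Y' Y0) /fubini_F /=.
rewrite -ge0_integralZr//; last 3 first.
- exact/measurable_EFinP.
- by move=> x _; rewrite lee_fin le_max lexx orbT.
- by apply: integral_ge0 => x _; rewrite lee_fin le_max lexx orbT.
apply: eq_integral => x _; rewrite /f/= -ge0_integralZl//.
- exact/measurable_EFinP.
- by move=> y _; rewrite lee_fin le_max lexx orbT.
- by rewrite lee_fin le_max lexx orbT.
Qed.

End Laws.

(** * Adaptedness of the compensator *)

Section HawkesMeasurability.
Context {d : measure_display} {Omega : measurableType d} {R : realType}.
Context (P : probability Omega R).
Variables (F : R -> set (set Omega)) (p : hawkes_param R).
Variables (tau : nat -> Omega -> R) (l0 : Omega -> R).
Hypothesis hp : positive_param p.
Hypothesis hN : hawkes P F p tau l0.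

Lemma hawkes_path (w : Omega) : jump_path (tau^~ w).
Proof.
split=> [i|i|]; [exact: (hawkes_jump_gt0 hN)|exact: (hawkes_jump_incr hN)|].
exact: (hawkes_jump_cvg hN).
Qed.

Let N (t : R) (w : Omega) : R := Defs.counting (tau^~ w) t.

(** The event that a jump occurs after [x < t] is the event that the count
    at time [x] is small, which belongs to [F x]. *)
Lemma measurable_min_jump (i : nat) (t : R) : 0 <= t ->
  measurable_wrt (F t) (fun w => Num.min (tau i w) t).
Proof.
move=> t0; have sF := filtration_sigma (hawkes_filtration hN) t0.
apply/(measurable_wrtP sF) => _; apply: (measurability _ (RGenOInfty.measurableE R)) => //.
move=> /= _ [_ [x ->] <-]; rewrite setTI.
have FE (B : set Omega) : measurable (B : set (g_sigma_algebraType (F t))) = F t B.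
  by rewrite /measurable/= (sigma_algebra_id sF).
rewrite FE; have [tx|xt] := leP t x.
  rewrite (_ : _ @^-1` _ = set0); first by case: sF.
  apply/seteqP; split => // w /=; rewrite in_itv/= andbT lt_min => /andP[_].
  by rewrite ltNge tx.
have [x0|x0] := ltP x 0.
  rewrite (_ : _ @^-1` _ = setT).
    by case: sF => s0 sC _; rewrite -setC0 -setTD; exact: sC.
  apply/seteqP; split => // w _ /=; rewrite in_itv/= andbT lt_min xt andbT.
  exact: (lt_trans x0 (hawkes_jump_gt0 hN _ _)).
apply: (filtration_incr (hawkes_filtration hN) x0 (ltW xt)).
rewrite (_ : _ @^-1` _ = N x @^-1` `]-oo, i.+1%:R[).
  exact: (hawkes_counting_adapted hN).
apply/seteqP; split => w /=; rewrite !in_itv/= andbT lt_min xt andbT;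
  by rewrite !ltNge (counting_leP (hawkes_path w)).
Qed.

Let hb : 0 < decay_rate p. Proof. by case: hp. Qed.

Lemma hawkes_compensator_cvg (t : R) (w : Omega) : 0 <= t ->
  base_rate p * t + (l0 w - base_rate p) * relax (decay_rate p) t
    + jump_size p * \sum_(i < n) relax (decay_rate p) (t - Num.min (tau i w) t)
  @[n --> \oo] --> compensator p (tau^~ w) (l0 w) t.
Proof.
move=> t0; have [m hm] := jump_path_late (hawkes_path w) t.
apply: cvg_near_cst; exists m => // n /= mn.
rewrite (compensatorE _ (hawkes_path w) hb t0 (n := n)); last first.
  by move=> i /(leq_trans mn)/hm/ltW.
congr (_ + _ * _); apply: eq_bigr => i _.
case: (leP (tau i w) t) => [//|ti].
by rewrite subrr relax0// relax0// subr_le0 ltW.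
Qed.

Lemma measurable_relax (b : R) : measurable_fun setT (relax b).
Proof.
apply: measurable_funM => //; apply: measurable_funB => //.
apply: measurableT_comp => //; apply: measurable_funM => //.
exact: measurable_maxr.
Qed.

(** A jump after [t] enters the closed form of the compensator only through
    [relax 0 = 0], so jump times may be capped at [t]. *)
Lemma measurable_compensator (t : R) : 0 <= t ->
  measurable_wrt (F t) (fun w => compensator p (tau^~ w) (l0 w) t).
Proof.
move=> t0; have sF := filtration_sigma (hawkes_filtration hN) t0.
apply/(measurable_wrtP sF).
apply: (@measurable_fun_cvg _ (g_sigma_algebraType (F t)) R setT (fun n w =>
  base_rate p * t + (l0 w - base_rate p) * relax (decay_rate p) t
    + jump_size p * \sum_(i < n) relax (decay_rate p) (t - Num.min (tau i w) t))).
- move=> n; have ml0 : measurable_fun setT (l0 : g_sigma_algebraType (F t) -> R).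
    apply/(measurable_wrtP sF) => B mB.
    apply: (filtration_incr (hawkes_filtration hN) (lexx 0) t0).
    exact: (hawkes_init_measurable hN).
  apply: measurable_funD.
    apply: measurable_funD => //; apply: measurable_funM => //.
    exact: measurable_funB.
  apply: measurable_funM => //; apply: measurable_sum => i.
  apply: (measurableT_comp (measurable_relax _)).
  apply: measurable_funB => //.
  by apply/(measurable_wrtP sF); exact: measurable_min_jump.
- by move=> w _; exact: hawkes_compensator_cvg.
Qed.

End HawkesMeasurability.

(** * One step of the exponential functional *)

Section RealStep.
Context {R : realType}.

Lemma expRN_le_sqr (u : R) : 0 <= u -> expR (- u) <= 1 - u + u ^+ 2.
Proof.
move=> u0; rewrite expRN; have h := expR_ge1Dx u.
have e0 := expR_gt0 u.
rewrite invf_ple ?posrE//; last by nra.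
have u1 : 0 < 1 - u + u ^+ 2 by nra.
by apply: le_trans h; rewrite invf_ple ?posrE//; last lra;
  rewrite -[leLHS]mul1r ler_pdivrMr; [nra|lra].
Qed.

(** One step of the exponential functional: [k] is the number of jumps of the
    step and [y] the increment of the compensator.  The second-order error is
    absorbed by the martingale increment [k - y] itself, since each jump adds
    at most [alpha dlt <= 1/2] to the compensator of the step. *)
Lemma exp_step (a alpha K dlt y b c1 c2 : R) (k : nat) :
    0 < a -> 0 <= alpha -> 0 <= K -> 0 <= dlt -> alpha * dlt <= 2^-1 ->
    0 <= y -> y <= dlt * (K + alpha * k%:R) ->
    b = expR a - 1 -> c1 = 2 * b * (K + alpha) ->
    c2 = b ^+ 2 * K ^+ 2 + c1 * K ->
  b * k%:R + expR (- (b * y))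
  <= 1 + (b + c1 * dlt) * (k%:R - y) + c2 * dlt ^+ 2.
Proof.
move=> a0 al0 K0 d0 ad y0 yd bE c1E c2E.
have b0 : 0 < b by rewrite bE subr_gt0 expR_gt1.
have c10 : 0 <= c1 by rewrite c1E !mulr_ge0// ?addr_ge0// ltW.
have by0 : 0 <= b * y by rewrite mulr_ge0// ltW.
case: k yd => [|k] yd.
  have h := expRN_le_sqr by0.
  have yK : y <= dlt * K by move: yd; rewrite mulr0 addr0.
  have y2 : y ^+ 2 <= (dlt * K) ^+ 2 by rewrite ler_pXn2r// nnegrE ?mulr_ge0.
  have h2 : (b * y) ^+ 2 <= b ^+ 2 * (dlt * K) ^+ 2.
    by rewrite exprMn ler_wpM2l// sqr_ge0.
  have h3 : c1 * dlt * y <= c1 * dlt * (dlt * K).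
    by rewrite ler_wpM2l// mulr_ge0.
  rewrite mulr0 add0r sub0r; apply: (le_trans h); rewrite c2E; rewrite exprMn in h2.
  lra.
set q : R := k.+1%:R; have q1 : 1 <= q by rewrite ler1n.
have h : expR (- (b * y)) <= 1 by rewrite expR_le1 oppr_le0.
have h1 : b * y <= b * (dlt * (K + alpha) * q).
  apply: ler_wpM2l; first exact: ltW.
  apply: (le_trans yd); rewrite -/q -mulrA.
  rewrite ler_wpM2l// mulrDl lerD2r; nra.
have h2 : q / 2 - dlt * K <= q - y.
  have : dlt * alpha * q <= 2^-1 * q.
    by rewrite ler_wpM2r ?(le_trans _ q1)// mulrC.
  by move: yd; rewrite -/q; lra.
have h3 : c1 * dlt * (q / 2 - dlt * K) <= c1 * dlt * (q - y).
  by rewrite ler_wpM2l// mulr_ge0.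
have h4 : 0 <= b ^+ 2 * K ^+ 2 * dlt ^+ 2 by rewrite -!exprMn sqr_ge0.
have h5 : c1 * dlt * (q / 2 - dlt * K)
    = b * (dlt * (K + alpha) * q) - c1 * K * dlt ^+ 2 by rewrite c1E; field.
rewrite c2E !mulrDl; lra.
Qed.

(** The weight [b = e^a - 1] is exact for zero or one jump; steps with more
    jumps are paid for by the constant [C]. *)
Lemma exp_jump (a y C b : R) (k : nat) : 0 < a -> 0 <= y ->
    ((1 < k)%N -> expR (a * k%:R) <= C) -> 0 <= C ->
    b = expR a - 1 ->
  expR (a * k%:R - b * y)
  <= b * k%:R + expR (- (b * y)) + C * (1 < k)%N%:R.
Proof.
move=> a0 y0 hC C0 bE; have b0 : 0 < b by rewrite bE subr_gt0 expR_gt1.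
have e1 : expR (- (b * y)) <= 1.
  by rewrite expR_le1 oppr_le0 mulr_ge0// ltW.
case: k hC => [_|[_|k hC]].
- by rewrite !mulr0 add0r add0r addr0.
- rewrite !mulr1 mulr0 addr0 expRD; have := expR_gt0 (- (b * y)).
  rewrite (_ : expR a = b + 1); last by rewrite bE subrK.
  nra.
rewrite mulr1 expRD; apply: (@le_trans _ _ C).
  by rewrite -[leRHS]mulr1 ler_pM ?expR_ge0// hC.
by rewrite lerDr addr_ge0 ?expR_ge0// mulr_ge0// ltW.
Qed.

End RealStep.

Section DoubleJumps.
Context {R : realType}.
Variables (T : nat -> R) (h : R) (n : nat).
Hypotheses (hT : jump_path T) (h0 : 0 <= h).

Definition grid (m k : nat) : R := h * (k%:R / m.+1%:R).

Lemma grid0 m : grid m 0 = 0. Proof. by rewrite /grid mul0r mulr0. Qed.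

Lemma grid_last m : grid m m.+1 = h.
Proof. by rewrite /grid divff ?mulr1// pnatr_eq0. Qed.

Lemma gridS m k : grid m k.+1 - grid m k = h / m.+1%:R.
Proof. by rewrite /grid -mulrBr -mulrBl -[k.+1%:R]natr1 addrAC subrr add0r mul1r. Qed.

Lemma grid_le m k : grid m k <= grid m k.+1.
Proof. by rewrite -subr_ge0 gridS divr_ge0. Qed.

Lemma grid_ge0 m k : 0 <= grid m k.
Proof. by rewrite /grid mulr_ge0// divr_ge0. Qed.

Definition double_jump (s t : R) : bool :=
  (Defs.counting T s + 2 <= Defs.counting T t) && (Defs.counting T t <= n%:R).

Definition double_jumps (m : nat) : R :=
  \sum_(k < m.+1) (double_jump (grid m k) (grid m k.+1))%:R.

Lemma double_jumps_ge0 m : 0 <= double_jumps m.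
Proof. by rewrite sumr_ge0. Qed.

(** Each step with two jumps raises the jump count, so there are at most [n]
    of them before the count exceeds [n]. *)
Lemma double_jumps_le m : double_jumps m <= n%:R.
Proof.
pose g k := Num.min (Defs.counting T (grid m k)) n%:R.
have : double_jumps m <= \sum_(k < m.+1) (g k.+1 - g k).
  apply: ler_sum => k _; rewrite /double_jump /g.
  have := counting_le hT (grid_le m k).
  set x := Defs.counting T (grid m k); set y := Defs.counting T (grid m k.+1) => xy.
  case: andP => [[xy2 yn]|_].
    by rewrite (min_l yn) (min_l (le_trans xy yn)) mulr1n; lra.
  by rewrite subr_ge0 le_min !ge_min xy lexx orbT.
move/le_trans; apply.
rewrite -(big_mkord xpredT (fun k => g k.+1 - g k)) telescope_sumr//.
rewrite /g grid0 (counting0 hT (lexx 0)) grid_last (min_l (ler0n _ _)) subr0.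
by rewrite ge_min lexx orbT.
Qed.

(** A step shorter than all gaps between the first jumps contains at most one
    of them. *)
Lemma double_jumps_cvg : double_jumps m @[m --> \oo] --> (0 : R).
Proof.
apply: cvg_near_cst.
have gap : \forall m \near \oo, forall i : 'I_n, h / m.+1%:R < T i.+1 - T i.
  apply: filter_forall => i.
  have gi : 0 < T i.+1 - T i by rewrite subr_gt0 jump_path_incr.
  have h1 : 0 < h + 1 by rewrite ltr_wpDl.
  have e0 : 0 < (T i.+1 - T i) / (h + 1) by rewrite divr_gt0.
  near=> m; rewrite (@le_lt_trans _ _ ((h + 1) * m.+1%:R^-1))//.
    by rewrite ler_wpM2r// ?invr_ge0// lerDl.
  rewrite mulrC -ltr_pdivlMr//.
  by near: m; exact: (near_infty_natSinv_lt (PosNum e0)).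
apply: filterS gap => m gap.
rewrite /double_jumps big1// => k _; rewrite /double_jump.
have [a Ha] := jumps_le hT (grid m k).
have [b Hb] := jumps_le hT (grid m k.+1).
rewrite (countingE hT Ha) (countingE hT Hb) -natrD !ler_nat.
case: andP => // -[ab bn].
have lt_an : (a < n)%N by apply: leq_trans bn; rewrite (leq_trans _ ab)// addn2.
have h1 : grid m k < T a by rewrite ltNge Ha ltnn.
have h2 : T a.+1 <= grid m k.+1 by rewrite Hb; rewrite addn2 in ab.
have := gap (Ordinal lt_an); rewrite /= -(gridS m k); lra.
Unshelve. all: by end_near.
Qed.

End DoubleJumps.

Section PathStep.
Context {R : realType}.
Variables (p : hawkes_param R) (T : nat -> R) (l0 m0 a b c1 c2 : R) (n : nat).
Hypotheses (hp : positive_param p) (hT : jump_path T).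
Hypotheses (l0_ge : base_rate p <= l0) (l0_le : l0 <= m0).
Let alpha := jump_size p.
Let K := m0 + alpha * n%:R.
Hypotheses (a_gt0 : 0 < a) (bE : b = expR a - 1).
Hypotheses (c1E : c1 = 2 * b * (K + alpha)) (c2E : c2 = b ^+ 2 * K ^+ 2 + c1 * K).

Local Notation N := (Defs.counting T).
Local Notation L := (compensator p T l0).

(** The step from [s] to [t] may be cut at [r] by the stopping time. In that
    case the functional is killed, and the right-hand side, which only sees
    the increments up to [r], is nonnegative. *)
Lemma path_step (s r t : R) (al : bool) : 0 <= s -> s <= r -> r <= t ->
    (al -> r = t) -> N s <= n%:R -> alpha * (t - s) <= 2^-1 ->
  (al && (N t <= n%:R))%:R * expR (a * N t - b * L t)
  <= expR (a * N s - b * L s) *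
     (1 + (b + c1 * (t - s)) * ((N r - L r) - (N s - L s)) + c2 * (t - s) ^+ 2
      + expR (a * n%:R) * (double_jump T n s t)%:R).
Proof.
move=> s0 sr rt alr Nsn dlt.
have [xi0 al0 be0] := hp.
have l00 : 0 <= l0 by rewrite (le_trans (ltW xi0)).
have [i Hi] := jumps_le hT s; have [j Hj] := jumps_le hT r.
have NsE := countingE hT Hi; have NrE := countingE hT Hj.
have ij : (i <= j)%N by have := counting_le hT sr; rewrite NsE NrE ler_nat.
have kE : N r - N s = (j - i)%N%:R by rewrite NsE NrE natrB.
have y0 : 0 <= L r - L s.
  by rewrite subr_ge0; apply: (compensator_le hT be0 l0_ge) => //; exact: ltW.
have K0 : 0 <= K by apply: addr_ge0; [exact: le_trans l00 l0_le|rewrite mulr_ge0// ltW].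
have yle : L r - L s <= (t - s) * (K + alpha * (j - i)%N%:R).
  have := compensator_lip hT be0 l0_ge (ltW al0) (ltW xi0) s0 sr.
  move/le_trans; apply; apply: ler_pM; rewrite ?subr_ge0 ?lerB//.
    by rewrite addr_ge0// mulr_ge0// ?NrE// ltW.
  rewrite /K -addrA lerD// -mulrDr ler_wpM2l// ?(ltW al0)//.
  by rewrite -kE NsE; move: Nsn; rewrite NsE; lra.
have d0 : 0 <= t - s by rewrite subr_ge0 (le_trans sr).
have := exp_step a_gt0 (ltW al0) K0 d0 dlt y0 yle bE c1E c2E.
rewrite (_ : (j - i)%:R - (L r - L s) = (N r - L r) - (N s - L s)); last first.
  by rewrite -kE; ring.
set X := 1 + _ + _ => step.
have X0 : 0 <= X.
  apply: le_trans step; rewrite addr_ge0 ?expR_ge0// mulr_ge0//.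
  by rewrite bE subr_ge0 -[leLHS]expR0 ler_expR ltW.
case: andP => [[/alr rtE Ntn]|_]; last first.
  by rewrite mul0r mulr_ge0 ?expR_ge0// addr_ge0// mulr_ge0// expR_ge0.
rewrite mul1r -rtE.
have -> : a * N r - b * L r
    = (a * N s - b * L s) + (a * (j - i)%:R - b * (L r - L s)).
  by rewrite -kE; ring.
rewrite expRD ler_wpM2l ?expR_ge0//.
have Nrn : (j <= n)%N by move: Ntn; rewrite -rtE NrE ler_nat.
apply: (@le_trans _ _ _ _ _ (exp_jump (C := expR (a * n%:R)) a_gt0 y0 _ _ bE)).
- move=> _; rewrite ler_expR ler_pM2l// ler_nat.
  by rewrite (leq_trans (leq_subr _ _)).
- exact: expR_ge0.
rewrite lerD// ler_wpM2l ?expR_ge0// /double_jump NsE NrE -natrD !ler_nat Nrn.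
by rewrite andbT ltn_subRL addn1 addn2.
Qed.

End PathStep.

(** * The exponential supermartingale *)

Section BoundedVariables.
Context {d : measure_display} {Omega : measurableType d} {R : realType}.
Variable P : probability Omega R.

Lemma bounded_RV_integrable (X : Omega -> R) (C : R) :
  measurable_fun setT X -> (forall w, `|X w| <= C) ->
  P.-integrable setT (EFin \o X).
Proof.
move=> mX XC; apply: (@le_integrable _ _ _ P setT measurableT _ (EFin \o cst C)).
- exact/measurable_EFinP.
- by move=> w _ /=; rewrite lee_fin (le_trans (XC w))// ler_norm.
- exact: finite_measure_integrable_cst.
Qed.

Lemma measurable_bool_natr (X : Omega -> bool) :
  measurable_fun setT X -> measurable_fun setT (fun w => (X w)%:R : R).
Proof.
move=> mX; rewrite (_ : (fun _ => _) = fun w => if X w then 1 else 0 : R).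
  exact: measurable_fun_ifT.
by apply/funext => w; case: (X w).
Qed.

End BoundedVariables.

Section StoppedSupermartingale.
Context {d : measure_display} {Omega : measurableType d} {R : realType}.
Context (P : probability Omega R).
Variables (F : R -> set (set Omega)) (p : hawkes_param R).
Variables (tau : nat -> Omega -> R) (l0 : Omega -> R).
Hypothesis hp : positive_param p.
Hypothesis hN : hawkes P F p tau l0.

Let N (t : R) (w : Omega) : R := Defs.counting (tau^~ w) t.
Let L (t : R) (w : Omega) : R := compensator p (tau^~ w) (l0 w) t.
Let M (t : R) (w : Omega) : R := N t w - L t w.

Variable S : Omega -> \bar R.
Hypothesis hS : stopping_time F S.
Hypothesis hM : martingale P F (stopped S (fun t w => M t w - M 0 w)).

Variables (W : Omega -> R) (C m0 a h : R) (n : nat).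
Hypotheses (mW : measurable_wrt (F 0) W) (W_bnd : forall w, 0 <= W w <= C).
Hypothesis W_supp : forall w, W w != 0 -> base_rate p <= l0 w <= m0.
Hypotheses (a_gt0 : 0 < a) (h_ge0 : 0 <= h).
Let b := expR a - 1.

(** The functional is killed at the stopping time and once more than [n]
    jumps have occurred; this makes it bounded. *)
Definition killed_exp (s : R) (w : Omega) : R :=
  if (s%:E < S w)%E && (N s w <= n%:R) then W w * expR (a * N s w - b * L s w)
  else 0.

Let Cv := C * expR (a * n%:R).
Let b_gt0 : 0 < b. Proof. by rewrite subr_gt0 expR_gt1. Qed.
Let path := hawkes_path hN.
Let C_ge0 : 0 <= C.
Proof. by have /andP[/le_trans] := W_bnd point; apply. Qed.

Lemma killed_exp_bnd (s : R) (w : Omega) : 0 <= s -> 0 <= killed_exp s w <= Cv.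
Proof.
have [xi0 al0 be0] := hp.
move=> s0; rewrite /killed_exp /Cv; have /andP[W0 WC] := W_bnd w.
case: ifPn => [/andP[_ Nn]|_]; last by rewrite lexx mulr_ge0// expR_ge0.
rewrite mulr_ge0 ?expR_ge0//=.
have [->|W_neq0] := eqVneq (W w) 0.
  by rewrite mul0r mulr_ge0// expR_ge0.
have /andP[l0w _] := W_supp W_neq0.
apply: ler_pM; rewrite ?expR_ge0// ler_expR lerBlDr (le_trans (y := a * n%:R))//.
  by rewrite ler_pM2l.
rewrite lerDl mulr_ge0 ?(ltW b_gt0)//.
rewrite -(compensator0 (l0 w) (path w) be0).
exact: (compensator_le (path w) be0 l0w (ltW al0) (ltW xi0)).
Qed.

Lemma measurable_killed_exp (s : R) : 0 <= s -> measurable_wrt (F s) (killed_exp s).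
Proof.
move=> s0; have sF := filtration_sigma (hawkes_filtration hN) s0.
have FE (B : set Omega) : measurable (B : set (g_sigma_algebraType (F s))) = F s B.
  by rewrite /measurable/= (sigma_algebra_id sF).
apply/(measurable_wrtP sF).
have mN : measurable_fun setT (N s : g_sigma_algebraType (F s) -> R).
  by apply/(measurable_wrtP sF); exact: (hawkes_counting_adapted hN).
have mL : measurable_fun setT (L s : g_sigma_algebraType (F s) -> R).
  by apply/(measurable_wrtP sF); exact: (measurable_compensator hp hN).
have mWs : measurable_fun setT (W : g_sigma_algebraType (F s) -> R).
  apply/(measurable_wrtP sF) => B mB.
  by apply: (filtration_incr (hawkes_filtration hN) (lexx 0) s0); exact: mW.
apply: measurable_fun_ifT => //.
- apply: measurable_and; last exact: measurable_fun_ler.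
  apply: (measurable_fun_bool true); rewrite setTI FE.
  rewrite (_ : _ @^-1` _ = setT `\` [set w | (S w <= s%:E)%E]).
    by case: sF => _ sC _; apply: sC; case: hS => _; exact.
  by apply/seteqP; split => w /=; rewrite ltNge; [move=> /negP|case=> _ /negP].
- apply: measurable_funM => //; apply: measurableT_comp => //.
  by apply: measurable_funB; exact: measurable_funM.
Qed.


Let Ms (t : R) (w : Omega) := stopped S (fun t w => M t w - M 0 w) t w.
Let K := m0 + jump_size p * n%:R.
Let c1 := 2 * b * (K + jump_size p).
Let c2 := b ^+ 2 * K ^+ 2 + c1 * K.
Let G := grid h.
Let dlt (m : nat) : R := h / m.+1%:R.

Let MsE (t : R) (w : Omega) : Ms t w = M (fine (Order.min t%:E (S w))) w.
Proof.
have [xi0 al0 be0] := hp.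
by rewrite /Ms /stopped {2}/M /N /L counting0// compensator0// !subr0.
Qed.

Let killed_exp_step (m k : nat) (w : Omega) : jump_size p * dlt m <= 2^-1 ->
  killed_exp (G m k.+1) w <= killed_exp (G m k) w
    + (b + c1 * dlt m) * (killed_exp (G m k) w * (Ms (G m k.+1) w - Ms (G m k) w))
    + Cv * `|c2| * dlt m ^+ 2
    + Cv * expR (a * n%:R) * (double_jump (tau^~ w) n (G m k) (G m k.+1))%:R.
Proof.
have [xi0 al0 be0] := hp.
move=> dm; have [s0 st] := (grid_ge0 h_ge0 m k, grid_le h_ge0 m k).
rewrite -/G in s0 st; have dE : G m k.+1 - G m k = dlt m by exact: gridS.
set s := G m k in s0 st dE *; set t := G m k.+1 in st dE *.
have Cv0 : 0 <= Cv by rewrite mulr_ge0// expR_ge0.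
have [V0 VC] := andP (killed_exp_bnd w s0).
have err : 0 <= Cv * `|c2| * dlt m ^+ 2
    + Cv * expR (a * n%:R) * (double_jump (tau^~ w) n s t)%:R.
  by rewrite addr_ge0// !mulr_ge0// ?expR_ge0// sqr_ge0.
have [[sS Nn]|] := pselect ((s%:E < S w)%E /\ N s w <= n%:R); last first.
  move=> nal; have -> : killed_exp t w = 0.
    rewrite /killed_exp; case: andP => // -[tS Nt]; exfalso; apply: nal; split.
      by apply: le_lt_trans tS; rewrite lee_fin.
    by apply: le_trans Nt; exact: counting_le.
  have -> : killed_exp s w = 0.
    by rewrite /killed_exp; case: andP => // -[? ?]; exfalso; exact: nal.
  by rewrite mul0r mulr0 !add0r.
have [W0|W_neq0] := eqVneq (W w) 0.
  rewrite (_ : killed_exp t w = 0); last first.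
    by rewrite /killed_exp; case: ifP => // _; rewrite W0 mul0r.
  rewrite (_ : killed_exp s w = 0); last first.
    by rewrite /killed_exp; case: ifP => // _; rewrite W0 mul0r.
  by rewrite mul0r mulr0 !add0r.
have /andP[l0w l0m] := W_supp W_neq0.
(* the end of the step, possibly advanced by the stopping time *)
pose r := fine (Order.min t%:E (S w)).
have rE : r%:E = Order.min t%:E (S w).
  rewrite /r fineK//; have [//|St] := leP t%:E (S w).
  by rewrite ge0_fin_numE ?(le_trans _ (ltW sS))//; rewrite (lt_le_trans St)// leey.
have sr : s <= r.
  by rewrite -lee_fin rE le_min lee_fin st ltW.
have rt : r <= t by rewrite -lee_fin rE ge_min lexx.
have MsEs : Ms s w = M s w by rewrite MsE min_l// ltW.
have MsEt : Ms t w = M r w by rewrite MsE.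
have alr : (t%:E < S w)%E -> r = t.
  by move=> tS; apply: EFin_inj; rewrite rE min_l// ltW.
have := path_step hp (path w) l0w l0m a_gt0 erefl erefl erefl s0 sr rt alr Nn.
rewrite dE => /(_ dm); rewrite -/b -/K -/c1 -/c2 => step.
have -> : killed_exp t w =
    W w * (((t%:E < S w)%E && (N t w <= n%:R))%:R * expR (a * N t w - b * L t w)).
  by rewrite /killed_exp; case: ifP => _; rewrite ?mul1r// mul0r mulr0.
have /andP[Ww0 _] := W_bnd w.
apply: (le_trans (ler_wpM2l Ww0 step)).
have VE : killed_exp s w = W w * expR (a * N s w - b * L s w).
  by rewrite /killed_exp sS Nn.
rewrite [leLHS]mulrA (_ : W w * expR _ = killed_exp s w); last by rewrite VE.
rewrite MsEt MsEs /M /N /L.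
set V := killed_exp s w; set D := _ - _ - _; set e := expR _; set dj := _%:R.
have h1 : V * (c2 * dlt m ^+ 2) <= Cv * `|c2| * dlt m ^+ 2.
  rewrite -mulrA; apply: (@le_trans _ _ (V * (`|c2| * dlt m ^+ 2))).
    by rewrite ler_wpM2l// ler_wpM2r ?sqr_ge0// ler_norm.
  by rewrite ler_wpM2r// mulr_ge0// sqr_ge0.
have h2 : V * (e * dj) <= Cv * e * dj.
  by rewrite -mulrA ler_wpM2r// mulr_ge0// expR_ge0.
rewrite !mulrDr mulr1; nra.
Qed.


Let mkilled (s : R) : 0 <= s -> measurable_fun setT (killed_exp s).
Proof.
move=> s0; apply: (measurable_wrt_fun (filtration_sub (hawkes_filtration hN) s0)).
exact: measurable_killed_exp.
Qed.

Let mWP : measurable_fun setT W.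
Proof.
exact: (measurable_wrt_fun (filtration_sub (hawkes_filtration hN) (lexx 0))).
Qed.

Let mdj (m : nat) : measurable_fun setT (fun w => double_jumps (tau^~ w) h n m).
Proof.
have mN t : 0 <= t -> measurable_fun setT (N t).
  move=> t0; apply: (measurable_wrt_fun (filtration_sub (hawkes_filtration hN) t0)).
  exact: (hawkes_counting_adapted hN).
apply: measurable_sum => k; apply: measurable_bool_natr.
have m1 := mN _ (grid_ge0 h_ge0 m k); have m2 := mN _ (grid_ge0 h_ge0 m k.+1).
apply: measurable_and; last exact: measurable_fun_ler.
by apply: measurable_fun_ler => //; exact: measurable_funD.
Qed.

Let increment0 (m k : nat) :
  P.-integrable setT (EFin \o (fun w => killed_exp (G m k) w
                                        * (Ms (G m k.+1) w - Ms (G m k) w))) /\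
  (\int[P]_w (killed_exp (G m k) w * (Ms (G m k.+1) w - Ms (G m k) w))%:E = 0)%E.
Proof.
have [s0 st] := (grid_ge0 h_ge0 m k, grid_le h_ge0 m k).
have t0 := grid_ge0 h_ge0 m k.+1.
have [iS iT] := (martingale_integrable hM s0, martingale_integrable hM t0).
have sub := filtration_sub (hawkes_filtration hN) s0.
apply: (integral_wrtM0 (filtration_sigma (hawkes_filtration hN) s0) sub
  (measurable_killed_exp s0) (fun w => killed_exp_bnd w s0)).
- have := integrableB measurableT iT iS; apply: eq_integrable => // w _.
- move=> B FB; have mB : measurable B by exact: sub.
  have [iS' iT'] := (integrableS measurableT mB (@subsetT _ _) iS,
                    integrableS measurableT mB (@subsetT _ _) iT).
  under eq_integral do rewrite EFinB.
  rewrite integralB// (martingale_cond hM s0 st FB) subee//.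
  exact: integrable_fin_num.
Qed.

Let error (m : nat) (w : Omega) : R :=
  Cv * `|c2| * dlt m ^+ 2 * m.+1%:R
  + Cv * expR (a * n%:R) * double_jumps (tau^~ w) h n m.

Let noise (m : nat) (w : Omega) : R :=
  (b + c1 * dlt m) * \sum_(k < m.+1)
    (killed_exp (G m k) w * (Ms (G m k.+1) w - Ms (G m k) w)).

Let killed_exp_le (m : nat) (w : Omega) : jump_size p * dlt m <= 2^-1 ->
  killed_exp h w <= (W w + error m w) + noise m w.
Proof.
have [xi0 al0 be0] := hp.
move=> dm; have V0 : killed_exp (G m 0) w <= W w.
  have /andP[W0 _] := W_bnd w.
  rewrite /G grid0 /killed_exp; case: ifP => // _.
  rewrite /N /L (counting0 (path w) (lexx 0)).
  rewrite (compensator0 _ (path w) be0).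
  by rewrite !mulr0 subr0 expR0 mulr1.
have : \sum_(k < m.+1) (killed_exp (G m k.+1) w - killed_exp (G m k) w) <=
    \sum_(k < m.+1) ((b + c1 * dlt m)
        * (killed_exp (G m k) w * (Ms (G m k.+1) w - Ms (G m k) w))
     + (Cv * `|c2| * dlt m ^+ 2
     + Cv * expR (a * n%:R)
       * (double_jump (tau^~ w) n (G m k) (G m k.+1))%:R)).
  by apply: ler_sum => k _; rewrite lerBlDl !addrA killed_exp_step.
rewrite -(big_mkord xpredT (fun k => killed_exp (G m k.+1) w - killed_exp (G m k) w)).
rewrite telescope_sumr// /G grid_last -/G big_split/= -mulr_sumr -/(noise m w).
rewrite big_split/= sumr_const card_ord -[X in _ + (X + _)]mulr_natr -mulr_sumr.
rewrite -/(double_jumps (tau^~ w) h n m) -/(error m w); lra.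
Qed.

Let noise0 (m : nat) : P.-integrable setT (EFin \o noise m) /\
  (\int[P]_w (noise m w)%:E = 0)%E.
Proof.
pose f k w := (killed_exp (G m k) w * (Ms (G m k.+1) w - Ms (G m k) w))%:E.
have E w : (noise m w)%:E = ((b + c1 * dlt m)%:E * \sum_(k < m.+1) f k w)%E.
  by rewrite /noise EFinM -sumEFin.
have ifk k : P.-integrable setT (f k) by have [] := increment0 m k.
have isum : P.-integrable setT (fun w => \sum_(k < m.+1) f k w)%E.
  by apply: integrable_sum => // k _; exact: ifk.
split.
  have -> : EFin \o noise m = (fun w => (b + c1 * dlt m)%:E * \sum_(k < m.+1) f k w)%E.
    exact/funext.
  exact: integrableZl.
under eq_integral do rewrite E.
rewrite integralZl// (integral_sum measurableT)//.
by rewrite big1 ?mule0// => k _; exact: (increment0 m k).2.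
Qed.

Let small (m0' : R) : 0 <= m0' -> \forall m \near \oo, m0' / m.+1%:R <= 2^-1.
Proof.
move=> m00; have e0 : (0 : R) < 2^-1 / (m0' + 1) by rewrite divr_gt0 ?ltr_wpDl.
near=> m; rewrite (@le_trans _ _ ((m0' + 1) * m.+1%:R^-1))//.
  by rewrite ler_wpM2r// ?invr_ge0// lerDl.
rewrite mulrC -ler_pdivlMr ?ltr_wpDl// ltW//.
by near: m; exact: (near_infty_natSinv_lt (PosNum e0)).
Unshelve. all: by end_near.
Qed.

(** Summing the steps, the martingale increments integrate to zero against
    weights known at the start of each step, and the remaining errors vanish
    as the grid is refined, by dominated convergence. *)
Lemma integral_killed_exp : (\int[P]_w (killed_exp h w)%:E <= \int[P]_w (W w)%:E)%E.
Proof.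
have [xi0 al0 be0] := hp.
have Cv0 : 0 <= Cv by rewrite mulr_ge0// expR_ge0.
have merr m : measurable_fun setT (error m).
  by apply: measurable_funD => //; exact: measurable_funM.
have err_ge0 m w : 0 <= error m w.
  rewrite addr_ge0// ?mulr_ge0// ?sqr_ge0// ?expR_ge0//.
  exact: double_jumps_ge0.
have dltE m : Cv * `|c2| * dlt m ^+ 2 * m.+1%:R = Cv * `|c2| * h ^+ 2 * m.+1%:R^-1.
  by rewrite /dlt; field; rewrite addrC natr1 pnatr_eq0.
have err_cvg w : error m w @[m --> \oo] --> (0 : R).
  rewrite /error; under eq_fun do rewrite dltE.
  have h1 : Cv * `|c2| * h ^+ 2 * m.+1%:R^-1 @[m --> \oo]
      --> Cv * `|c2| * h ^+ 2 * 0 by apply: cvgMr; exact: cvg_harmonic.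
  have h2 : Cv * expR (a * n%:R) * double_jumps (tau^~ w) h n m @[m --> \oo]
      --> Cv * expR (a * n%:R) * 0.
    by apply: cvgMr; exact: (double_jumps_cvg n (path w) h_ge0).
  have : Cv * `|c2| * h ^+ 2 * m.+1%:R^-1
      + Cv * expR (a * n%:R) * double_jumps (tau^~ w) h n m @[m --> \oo]
      --> Cv * `|c2| * h ^+ 2 * 0 + Cv * expR (a * n%:R) * 0 by exact: cvgD.
  by rewrite !mulr0 addr0.
have err_bnd m w : error m w <= Cv * `|c2| * h ^+ 2 + Cv * expR (a * n%:R) * n%:R.
  rewrite /error dltE lerD//.
    by rewrite ler_piMr ?mulr_ge0 ?sqr_ge0// invf_le1 ?ltr0n// ler1n.
  rewrite ler_wpM2l ?mulr_ge0 ?expR_ge0//.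
  by apply: double_jumps_le; [exact: path|].
have iW : P.-integrable setT (EFin \o W).
  apply: (bounded_RV_integrable _ mWP (C := C)) => w.
  by have /andP[W0 WC] := W_bnd w; rewrite ger0_norm.
have iV : P.-integrable setT (EFin \o killed_exp h).
  apply: (bounded_RV_integrable _ (mkilled h_ge0) (C := Cv)) => w.
  by have /andP[V0 VC] := killed_exp_bnd w h_ge0; rewrite ger0_norm.
set B := Cv * `|c2| * h ^+ 2 + Cv * expR (a * n%:R) * n%:R in err_bnd.
have WB m w : `|W w + error m w| <= C + B.
  have /andP[W0 WC] := W_bnd w.
  rewrite ger0_norm; first exact: lerD.
  by apply: addr_ge0 => //; exact: err_ge0.
have mWe m : measurable_fun setT (fun w => W w + error m w) by exact: measurable_funD.
have iWe m : P.-integrable setT (EFin \o (fun w => W w + error m w)).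
  exact: (bounded_RV_integrable _ (mWe m) (WB m)).
have H : (\int[P]_w (W w + error m w)%R%:E @[m --> \oo] --> \int[P]_w (W w)%:E)%E.
  have [] := @dominated_convergence _ _ _ P setT measurableT
    (fun m w => (W w + error m w)%:E) (EFin \o W) (EFin \o cst (C + B)).
  - by move=> m; exact/measurable_EFinP.
  - exact/measurable_EFinP.
  - apply: aeW => w _; apply/fine_cvgP; split; first exact: nearW.
    have : W w + error m w @[m --> \oo] --> W w + 0.
      by apply: cvgD; [exact: cvg_cst|exact: err_cvg].
    by rewrite addr0.
  - exact: finite_measure_integrable_cst.
  - by apply: aeW => w m _; rewrite lee_fin; exact: WB.
  - by [].
apply: (cvge_to_ge H).
have : \forall m \near \oo, jump_size p * dlt m <= 2^-1.
  have := small (mulr_ge0 (ltW al0) h_ge0); apply: filterS => m.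
  by rewrite -mulrA.
apply: filterS => m dm.
have [iZ Z0] := noise0 m.
have -> : (\int[P]_w (W w + error m w)%:E
    = \int[P]_w ((W w + error m w) + noise m w)%:E)%E.
  under [RHS]eq_integral do rewrite EFinD.
  by rewrite [RHS](integralD measurableT (iWe m) iZ) Z0 adde0.
apply: le_integral => //.
  exact: integrable_EFinD.
by move=> w _; rewrite /= lee_fin killed_exp_le.
Qed.

End StoppedSupermartingale.

Section Supermartingale.
Context {d : measure_display} {Omega : measurableType d} {R : realType}.
Context (P : probability Omega R).
Variables (F : R -> set (set Omega)) (p : hawkes_param R).
Variables (tau : nat -> Omega -> R) (l0 : Omega -> R).
Hypothesis hp : positive_param p.
Hypothesis hN : hawkes P F p tau l0.

Let N (t : R) (w : Omega) : R := Defs.counting (tau^~ w) t.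
Let L (t : R) (w : Omega) : R := compensator p (tau^~ w) (l0 w) t.

Lemma measurable_countingP (t : R) : 0 <= t ->
  measurable_fun setT (fun w => Defs.counting (tau^~ w) t).
Proof.
move=> t0; apply: (measurable_wrt_fun (filtration_sub (hawkes_filtration hN) t0)).
exact: (hawkes_counting_adapted hN).
Qed.

Lemma measurable_compensatorP (t : R) : 0 <= t ->
  measurable_fun setT (fun w => compensator p (tau^~ w) (l0 w) t).
Proof.
move=> t0; apply: (measurable_wrt_fun (filtration_sub (hawkes_filtration hN) t0)).
exact: (measurable_compensator hp hN).
Qed.

Lemma measurable_initP : measurable_fun setT l0.
Proof.
apply: (measurable_wrt_fun (filtration_sub (hawkes_filtration hN) (lexx 0))).
exact: (hawkes_init_measurable hN).
Qed.

Lemma measurable_jump (i : nat) : measurable_fun setT (tau i).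
Proof.
apply: (@measurable_fun_cvg _ Omega R setT (fun n w => Num.min (tau i w) n%:R)).
- move=> n.
  apply: (measurable_wrt_fun (filtration_sub (hawkes_filtration hN) (ler0n _ n))).
  exact: (measurable_min_jump hN).
- move=> w _; apply: cvg_near_cst.
  have := nbhs_infty_ger (tau i w); apply: filterS => n /= nt.
  by rewrite min_l.
Qed.

Lemma measurable_intensity (q : Omega -> hawkes_param R) (m0 : Omega -> R) (t : R) :
    measurable_fun setT (fun w => base_rate (q w)) ->
    measurable_fun setT (fun w => jump_size (q w)) ->
    measurable_fun setT (fun w => decay_rate (q w)) ->
    measurable_fun setT m0 ->
  measurable_fun setT (fun w => intensity (q w) (tau^~ w) (m0 w) t).
Proof.
move=> mb mj md mm.
have mexp (c : Omega -> R) : measurable_fun setT c ->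
    measurable_fun setT (fun w => expR (- decay_rate (q w) * c w)).
  move=> mc; apply: measurableT_comp => //; apply: measurable_funM => //.
  exact: measurableT_comp.
apply: (@measurable_fun_cvg _ Omega R setT (fun n w =>
  base_rate (q w) + (m0 w - base_rate (q w)) * expR (- decay_rate (q w) * t)
  + \sum_(i < n) (if tau i w < t
      then jump_size (q w) * expR (- decay_rate (q w) * (t - tau i w)) else 0))).
- move=> n; apply: measurable_funD.
    apply: measurable_funD => //; apply: measurable_funM => //.
      exact: measurable_funB.
    exact: mexp.
  apply: measurable_sum => i; have mi := measurable_jump i.
  apply: measurable_fun_ifT => //; first exact: measurable_fun_ltr.
  by apply: measurable_funM => //; apply: mexp; exact: measurable_funB.
- move=> w _; have [m hm] := jump_path_late (hawkes_path hN w) t.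
  apply: cvg_near_cst; exists m => // n /= mn.
  rewrite /intensity (count_int_oo (hawkes_path hN w) _ (n := n))//.
  by move=> i /(leq_trans mn)/hm/ltW.
Qed.

Variables (W : Omega -> R) (C m0 a h : R).
Hypotheses (mW : measurable_wrt (F 0) W) (W_bnd : forall w, 0 <= W w <= C).
Hypothesis W_supp : forall w, W w != 0 -> base_rate p <= l0 w <= m0.
Hypotheses (a_gt0 : 0 < a) (h_ge0 : 0 <= h).

(** The killing is removed by monotone convergence along the localizing
    sequence. *)
Lemma exp_supermartingale :
  (\int[P]_w (W w * expR (a * N h w - (expR a - 1) * L h w))%:E
   <= \int[P]_w (W w)%:E)%E.
Proof.
have [S [hS Smono Scvg hM]] := hawkes_local_martingale hN.
pose f j w := (killed_exp p tau l0 (S j) W a j h w)%:E.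
pose g w := (W w * expR (a * N h w - (expR a - 1) * L h w))%:E.
have sub0 := filtration_sub (hawkes_filtration hN) h_ge0.
have mf j : measurable_fun setT (f j).
  apply/measurable_EFinP; apply: (measurable_wrt_fun sub0).
  exact: (measurable_killed_exp hp hN (hS j)).
have f0 j w : (0 <= f j w)%E.
  have [] := andP (killed_exp_bnd hp hN (S j) j W_bnd W_supp a_gt0 w h_ge0).
  by rewrite lee_fin.
have ndf w : nondecreasing_seq (f ^~ w).
  apply/nondecreasing_seqP => j; rewrite /f lee_fin /killed_exp.
  have /andP[W0 _] := W_bnd w.
  case: (boolP (_ && _)) => [/andP[hSj Nj]|_]; last first.
    by case: ifP => // _; rewrite mulr_ge0// expR_ge0.
  rewrite ifT// (lt_le_trans hSj (Smono _ _))/= (le_trans Nj)// ler_nat//.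
have intf j : (\int[P]_w f j w <= \int[P]_w (W w)%:E)%E.
  exact: (integral_killed_exp hp hN (hS j) (hM j) j mW W_bnd W_supp a_gt0 h_ge0).
pose F' w := limn (f ^~ w).
have fF w : f ^~ w @ \oo --> F' w by exact: ereal_nondecreasing_is_cvgn.
have mF : measurable_fun setT F'.
  by apply: (emeasurable_fun_cvg f) => // w _; exact: fF.
have F0 w : (0 <= F' w)%E.
  by apply: lime_ge; [exact: fF|exact: nearW].
have mg : measurable_fun setT g.
  apply/measurable_EFinP; apply: measurable_funM.
    apply: (measurable_wrt_fun (filtration_sub (hawkes_filtration hN) (lexx 0))).
    exact: mW.
  apply: measurableT_comp => //; apply: measurable_funB; apply: measurable_funM => //.
    exact: measurable_countingP.
  exact: measurable_compensatorP.
apply: (@le_trans _ _ (\int[P]_w F' w)%E).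
  apply: ae_ge0_le_integral => //.
    move=> w _; rewrite lee_fin mulr_ge0 ?expR_ge0//.
    by have /andP[] := W_bnd w.
  apply: filterS Scvg => w Sw _; rewrite /F'.
  suff H : \forall j \near \oo, f j w = g w.
    by rewrite (lim_near_cst _ H).
  have [nN NE] := counting_nat (hawkes_path hN w) h.
  have HS : \forall j \near \oo, (h%:E < S j w)%E.
    by move/cvgeyPgt : Sw; exact.
  near=> j; rewrite /f /g /killed_exp ifT//; apply/andP; split.
    by near: j.
  by rewrite NE ler_nat; near: j; exact: nbhs_infty_ge.
have H := cvg_monotone_convergence measurableT mf (fun j w _ => f0 j w)
  (fun w _ => ndf w).
by apply: (cvge_to_le (H P)); exact: nearW.
Unshelve. all: by end_near.
Qed.

End Supermartingale.

(** * Exponential moments of the stationary intensity *)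

Section ExponentialMoment.
Context {d : measure_display} {Omega : measurableType d} {R : realType}.
Context (P : probability Omega R).
Variables (F : R -> set (set Omega)) (p : hawkes_param R).
Variables (tau : nat -> Omega -> R) (l0 : Omega -> R).
Hypotheses (hp : positive_param p) (hsub : subcritical p).
Hypothesis hS : stationary_hawkes P F p tau l0.
Let hN := stationary_hawkes_hawkes hS.

Let lam (t : R) (w : Omega) : R := intensity p (tau^~ w) (l0 w) t.

Lemma intensity0 (w : Omega) : lam 0 w = l0 w.
Proof.
have hw := hawkes_path hN w.
rewrite /lam /intensity (@count_int_oo _ _ hw 0 _ 0); last first.
  by move=> i _; exact/ltW/(jump_path_gt0 hw).
by rewrite big_ord0 mulr0 expR0 mulr1 addr0 addrC subrK.
Qed.

Lemma measurable_lam (t : R) : measurable_fun setT (lam t).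
Proof. by apply: (measurable_intensity hN) => //; exact: (measurable_initP hN). Qed.

Lemma intensity_same_law (t : R) (B : set R) : 0 <= t -> measurable B ->
  P (lam t @^-1` B) = P (l0 @^-1` B).
Proof.
move=> t0 mB.
have H := stationary_hawkes_stationary hS.
have := H 1%N (fun=> 0) (fun=> B) t (fun i => lexx 0) t0 (fun i => mB).
have E (s : R) : \bigcap_(i in [set: 'I_1]) (lam s @^-1` B) = lam s @^-1` B.
  by apply/seteqP; split => [w /(_ ord0 I)//|w h i _].
rewrite add0r -/(lam t) -/(lam 0) !E => ->.
by congr (P _); apply/seteqP; split => w /=; rewrite intensity0.
Qed.

Lemma integral_intensity (t : R) (f : R -> \bar R) : 0 <= t ->
  measurable_fun setT f -> (forall x, 0 <= f x)%E ->
  (\int[P]_w f (lam t w) = \int[P]_w f (l0 w))%E.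
Proof.
move=> t0 mf f0; apply: integral_same_law => //.
- exact: measurable_lam.
- exact: (measurable_initP hN).
- by move=> B mB; exact: intensity_same_law.
Qed.

(** To first order in [c] this is subcriticality, [alpha < beta]; it makes the
    drift of [e^{c lambda}] negative when [lambda] is large. *)
Lemma subcritical_exponent :
  exists2 c : R, 0 < c & expR (c * jump_size p) - 1 < c * decay_rate p.
Proof.
have [_ al0 be0] := hp.
set al := jump_size p in al0 *; set be := decay_rate p in be0 *.
have r1 : al / be < 1 := hsub.
have r0 : 0 < al / be by rewrite divr_gt0.
pose x := (1 - al / be) / 2.
have x0 : 0 < x by rewrite divr_gt0// subr_gt0.
have x1 : x < 1 - al / be by rewrite /x; lra.
exists (x / al); first by rewrite divr_gt0.
rewrite divfK ?gt_eqF//.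
have h : expR x <= (1 - x)^-1.
  rewrite -[x in expR x]opprK expRN lef_pV2 ?posrE ?expR_gt0//; last by lra.
  by have := expR_ge1Dx (- x).
apply: (@le_lt_trans _ _ ((1 - x)^-1 - 1)); first by rewrite lerD2r.
rewrite (_ : _ - 1 = x / (1 - x)); last by field; rewrite gt_eqF//; lra.
have -> : x / al * be = x * (be / al) by field; rewrite gt_eqF.
rewrite ltr_pM2l// invf_plt ?posrE ?divr_gt0//; last by lra.
by rewrite invf_div; lra.
Qed.

(** Along one unit of time, [E(e^{c lambda_1} | F_0) <= e^{c lambda_0} / 2 + K]
    for some constant [K]; since [lambda_1] and [lambda_0] have the same law,
    comparing the truncations of both sides at [m] bounds [E e^{c lambda_0}]. *)
Lemma exp_moment : exists2 c : R, 0 < c &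
  (\int[P]_w (expR (c * l0 w))%:E < +oo)%E.
Proof.
have [xi0 al0 be0] := hp.
have [c c0 hc] := subcritical_exponent.
exists c => //.
set al := jump_size p in al0 hc; set be := decay_rate p in be0 hc.
set xi := base_rate p in xi0.
pose a := c * al; have a0 : 0 < a by rewrite mulr_gt0.
pose kap := c * be - (expR a - 1).
have kap0 : 0 < kap by rewrite /kap subr_gt0 /a.
pose rho := kap * relax be 1.
have rho0 : 0 < rho by rewrite mulr_gt0// relax_gt0.
pose g := c * (be * xi).
have g0 : 0 < g by rewrite !mulr_gt0.
pose K := expR (c * ((g + 1) / rho) + g).
have K0 : 0 < K by exact: expR_gt0.
pose Z (w : Omega) := expR (c * l0 w).
pose D (w : Omega) := Z w / 2 + K.
pose E1 (w : Omega) := expR ((c - rho) * l0 w + g).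
have Z0 w : 0 < Z w by exact: expR_gt0.
have D0 w : 0 < D w by rewrite addr_gt0// divr_gt0.
(* For large [lambda_0] the contraction wins a factor [1/2]; [K] covers the
   rest. *)
have E1D w : 0 <= l0 w -> E1 w <= D w.
  move=> l00; rewrite /E1 /D.
  have [big|small] := leP (g + 1) (rho * l0 w).
    apply: (@le_trans _ _ (Z w / 2)); last by rewrite lerDl ltW.
    rewrite ler_pdivlMr//; apply: (@le_trans _ _ (E1 w * expR 1)).
      rewrite ler_wpM2l ?expR_ge0//.
      by have := expR_ge1Dx (1 : R); rewrite -[1 + 1]/(2 : R).
    by rewrite /E1 /Z -expRD ler_expR; nra.
  apply: (@le_trans _ _ K); last by rewrite lerDr divr_ge0// ltW.
  have sm : l0 w <= (g + 1) / rho by rewrite ler_pdivlMr// mulrC ltW.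
  rewrite /K ler_expR lerD2r (@le_trans _ _ (c * l0 w))//.
    by rewrite ler_wpM2r// gerBl ltW.
  by rewrite ler_pM2l.
(* [c lambda_1] is at most [c lambda_0 + g + (a N - b Lambda) - kap Lambda],
   where [Lambda >= lambda_0 relax(1)] produces the contraction [rho]. *)
have lam1 w : xi <= l0 w ->
    expR (c * lam 1 w) <= E1 w * expR (a * Defs.counting (tau^~ w) 1
      - (expR a - 1) * compensator p (tau^~ w) (l0 w) 1).
  move=> xil; have hw := hawkes_path hN w.
  have [n Hn] := jumps_lt hw 1; have [n' Hn'] := jumps_le hw 1.
  rewrite /lam (intensity_compensator (l0 w) hw be0 ler01 Hn).
  have nn' : n%:R <= Defs.counting (tau^~ w) 1 :> R.
    rewrite (countingE hw Hn') ler_nat leqNgt; apply/negP => n'n.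
    have : tau n' w < 1 by rewrite Hn.
    by move/ltW; rewrite Hn' ltnn.
  have hL := compensator_ge (l0 w) hw be0 (ltW al0) (ltW xi0) ler01.
  rewrite -expRD ler_expR -/be -/xi -/al.
  have h1 := ler_wpM2l (ltW kap0) hL; have h2 := ler_wpM2l (ltW a0) nn'.
  move: h1 h2; rewrite /rho /g /kap /a -/be.
  set L := compensator _ _ _ _; set N := Defs.counting _ _; set k := relax _ _.
  move=> h1 h2; lra.
have ml0 : measurable_fun setT l0 by exact: (measurable_initP hN).
have mZ : measurable_fun setT Z.
  by apply: measurableT_comp => //; exact: measurable_funM.
have mD : measurable_fun setT D.
  by apply: measurable_funD => //; exact: measurable_funM.
have mE1 : measurable_fun setT E1.
  apply: measurableT_comp => //.
  by apply: measurable_funD => //; exact: measurable_funM.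
have sF := filtration_sigma (hawkes_filtration hN) (lexx 0).
have trunc (m : R) : 0 <= m ->
    (\int[P]_w (if Z w <= m then Z w / 2 else 0)%R%:E <= K%:E)%E.
  move=> m_ge0.
  (* On [D <= m] the initial intensity is bounded and the supermartingale
     applies; elsewhere both truncations are at most [m]. *)
  pose W w := if (xi <= l0 w) && (D w <= m) then E1 w else 0.
  have mWF : measurable_wrt (F 0) W.
    apply/(measurable_wrtP sF).
    have ml : measurable_fun setT (l0 : g_sigma_algebraType (F 0) -> R).
      by apply/(measurable_wrtP sF); exact: (hawkes_init_measurable hN).
    apply: measurable_fun_ifT => //; last first.
      apply: measurableT_comp => //.
      by apply: measurable_funD => //; exact: measurable_funM.
    apply: measurable_and; first exact: measurable_fun_ler.
    apply: measurable_fun_ler => //; apply: measurable_funD => //.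
    apply: measurable_funM => //; apply: measurableT_comp => //.
    exact: measurable_funM.
  have W_bnd w : 0 <= W w <= m.
    rewrite /W; case: ifPn => [/andP[xil Dm]|_]; last by rewrite lexx.
    by rewrite expR_ge0 (le_trans (E1D w _))// (le_trans (ltW xi0)).
  have W_supp w : W w != 0 -> xi <= l0 w <= 2 * m / c.
    rewrite /W; case: ifPn => [/andP[xil Dm] _|]; last by rewrite eqxx.
    rewrite xil/= ler_pdivlMr// mulrC.
    by have := expR_ge1Dx (c * l0 w); rewrite -/(Z w); move: Dm; rewrite /D; lra.
  have EW := exp_supermartingale hp hN mWF W_bnd W_supp a0 ler01.
  pose U w := expR (a * Defs.counting (tau^~ w) 1
    - (expR a - 1) * compensator p (tau^~ w) (l0 w) 1).
  have {}EW : (\int[P]_w (W w * U w)%:E <= \int[P]_w (W w)%:E)%E := EW.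
  have mU : measurable_fun setT U.
    apply: measurableT_comp => //; apply: measurable_funB; apply: measurable_funM => //.
      exact: (measurable_countingP hN).
    exact: (measurable_compensatorP hp hN).
  have mW : measurable_fun setT W.
    exact: (measurable_wrt_fun (filtration_sub (hawkes_filtration hN) (lexx 0))).
  pose V w := if D w <= m then 0 else m.
  have mV : measurable_fun setT V.
    by apply: measurable_fun_ifT => //; exact: measurable_fun_ler.
  have V0 w : 0 <= V w by rewrite /V; case: ifP.
  have W0 w : 0 <= W w by have /andP[] := W_bnd w.
  have U0 w : 0 <= U w by exact: expR_ge0.
  have mmin (X : Omega -> R) : measurable_fun setT X ->
      measurable_fun setT (fun w => Num.min (X w) m).
    by move=> mX; exact: measurable_minr.
  have mZ1 : measurable_fun setT (fun w => expR (c * lam 1 w)).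
    apply: measurableT_comp => //; apply: measurable_funM => //.
    exact: measurable_lam.
  have min0 (x : R) : 0 <= x -> 0 <= Num.min x m by move=> x0; rewrite le_min x0.
  have key : (\int[P]_w (Num.min (expR (c * lam 1 w)) m)%:E
      <= \int[P]_w (Num.min (D w) m)%:E)%E.
    apply: (@le_trans _ _ (\int[P]_w (W w * U w + V w)%:E)%E).
      apply: ae_ge0_le_integral => //.
      - by move=> w _; rewrite lee_fin min0// expR_ge0.
      - by apply/measurable_EFinP; exact: mmin.
      - by move=> w _; rewrite lee_fin addr_ge0// mulr_ge0.
      - apply/measurable_EFinP; apply: measurable_funD => //.
        exact: measurable_funM.
      - apply: filterS (stationary_hawkes_init_ge hS) => w xil _.
        rewrite lee_fin /W /V xil/=; case: ifPn => Dm.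
          by rewrite addr0 ge_min lam1.
        by rewrite mul0r add0r ge_min lexx orbT.
    under eq_integral do rewrite EFinD.
    rewrite ge0_integralD//; last 4 first.
    - by move=> w _; rewrite lee_fin mulr_ge0.
    - by apply/measurable_EFinP; exact: measurable_funM.
    - by move=> w _; rewrite lee_fin.
    - exact/measurable_EFinP.
    apply: (@le_trans _ _ (\int[P]_w (W w)%:E + \int[P]_w (V w)%:E)%E).
      exact: leeD2r.
    rewrite -ge0_integralD//; last 4 first.
    - by move=> w _; rewrite lee_fin.
    - exact/measurable_EFinP.
    - by move=> w _; rewrite lee_fin.
    - exact/measurable_EFinP.
    apply: ge0_le_integral => //.
    - by move=> w _; rewrite -EFinD lee_fin addr_ge0.
    - by apply/measurable_EFinP; exact: measurable_funD.
    - by apply/measurable_EFinP; exact: mmin.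
    - move=> w _; rewrite -EFinD lee_fin /W /V.
      have [Dm|Dm] := leP (D w) m.
        rewrite andbT addr0; case: ifPn => [xil|_]; last exact: ltW.
        by rewrite E1D// (le_trans (ltW xi0)).
      by rewrite andbF add0r.
  have law : (\int[P]_w (Num.min (expR (c * lam 1 w)) m)%:E
      = \int[P]_w (Num.min (Z w) m)%:E)%E.
    apply: (integral_intensity (f := fun x => (Num.min (expR (c * x)) m)%:E)) => //.
      apply/measurable_EFinP; apply: measurable_minr => //.
      by apply: measurableT_comp => //; exact: measurable_funM.
    by move=> x; rewrite lee_fin min0// expR_ge0.
  have mH : measurable_fun setT (fun w => if Z w <= m then Z w / 2 else 0).
    apply: measurable_fun_ifT => //; first exact: measurable_fun_ler.
    exact: measurable_funM.
  have H0 w : 0 <= (if Z w <= m then Z w / 2 else 0).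
    by case: ifP => // _; rewrite divr_ge0// ltW.
  have minD0 w : 0 <= Num.min (D w) m by rewrite min0// ltW.
  have minZ0 w : 0 <= Num.min (Z w) m by rewrite min0// ltW.
  have finD : (\int[P]_w (Num.min (D w) m)%:E)%E \is a fin_num.
    apply: integrable_fin_num => //.
    apply: (@bounded_RV_integrable _ _ _ P (fun w => Num.min (D w) m) m).
      exact: mmin.
    by move=> w; rewrite ger0_norm// ge_min lexx orbT.
  rewrite -(leeD2lE _ _ finD).
  apply: (@le_trans _ _ (\int[P]_w (Num.min (Z w) m)%:E + K%:E)%E); last first.
    by rewrite leeD2r// -law.
  rewrite -ge0_integralD//; last 4 first.
  - by move=> w _; rewrite lee_fin.
  - by apply/measurable_EFinP; exact: mmin.
  - by move=> w _; rewrite lee_fin.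
  - exact/measurable_EFinP.
  have -> : K%:E = (\int[P]_w (cst K%:E w))%E.
    by rewrite integral_cst//= probability_setT mule1.
  rewrite -ge0_integralD//; last 3 first.
  - by move=> w _; rewrite lee_fin.
  - by apply/measurable_EFinP; exact: mmin.
  - by move=> w _; rewrite lee_fin ltW.
  apply: ge0_le_integral => //.
  - by move=> w _; rewrite -EFinD lee_fin addr_ge0.
  - by apply/measurable_EFinP; apply: measurable_funD => //; exact: mmin.
  - by apply/measurable_EFinP; apply: measurable_funD => //; exact: mmin.
  - move=> w _; rewrite -!EFinD lee_fin /= /D; have := Z0 w.
    by case: (leP (Z w) m) => Zm; case: (leP (Z w / 2 + K) m) => Dm; lra.
pose f n w := (if Z w <= n%:R then Z w / 2 else 0)%:E.
have f0 n w : (0 <= f n w)%E.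
  by rewrite /f lee_fin; case: ifP => // _; rewrite divr_ge0// ltW.
have mf n : measurable_fun setT (f n).
  apply/measurable_EFinP; apply: measurable_fun_ifT => //.
    exact: measurable_fun_ler.
  exact: measurable_funM.
have ndf w : nondecreasing_seq (f ^~ w).
  apply/nondecreasing_seqP => n; rewrite /f lee_fin; case: ifPn => [Zn|_].
    by rewrite ifT// (le_trans Zn)// ler_nat.
  by case: ifP => // _; rewrite divr_ge0// ltW.
have H := cvg_monotone_convergence measurableT mf (fun n w _ => f0 n w)
  (fun w _ => ndf w).
have limf w : limn (f ^~ w) = (Z w / 2)%:E.
  apply: lim_near_cst => //; have := nbhs_infty_ger (Z w).
  by apply: filterS => n /= Zn; rewrite /f Zn.
have : (\int[P]_w (Z w / 2)%:E <= K%:E)%E.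
  under eq_integral do rewrite -limf.
  by apply: (cvge_to_le (H P)); apply: nearW => n; exact: trunc.
under eq_integral do rewrite mulrC EFinM.
rewrite ge0_integralZl//; last 2 first.
- exact/measurable_EFinP.
- by move=> w _; rewrite lee_fin ltW.
rewrite lee_pdivrMl// => /le_lt_trans; apply.
by rewrite -EFinM ltry.
Qed.

End ExponentialMoment.

(** * Norms of order q *)

Section Norms.
Context {d : measure_display} {Omega : measurableType d} {R : realType}.
Variables (P : probability Omega R) (q : R).
Hypothesis q_ge1 : 1 <= q.
Let q_gt0 : 0 < q. Proof. exact: lt_le_trans q_ge1. Qed.
Let q_ge0 : 0 <= q. Proof. exact: ltW. Qed.

Definition normq (X : Omega -> R) : \bar R := 'N[P]_(q%:E)[EFin \o X].

Lemma normqE (X : Omega -> R) :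
  normq X = (('E_P[(fun w => `|X w| `^ q)%R]) `^ q^-1)%E.
Proof. by rewrite /normq unlock [in RHS]unlock. Qed.

Lemma normq_ge0 (X : Omega -> R) : (0 <= normq X)%E.
Proof. exact: Lnorm_ge0. Qed.

Lemma measurable_norm_powR (X : Omega -> R) : measurable_fun setT X ->
  measurable_fun setT (fun w => (`|X w| `^ q)%:E).
Proof.
move=> mX; apply/measurable_EFinP; apply: (measurableT_comp (measurable_powR q)).
exact: measurableT_comp.
Qed.

Lemma le_normq (X Y : Omega -> R) :
    measurable_fun setT X -> measurable_fun setT Y ->
    {ae P, forall w, `|X w| <= `|Y w|} ->
  (normq X <= normq Y)%E.
Proof.
move=> mX mY XY; rewrite !normqE gt0_ler_poweR//.
- by rewrite invr_ge0.
- rewrite in_itv/= leey andbT unlock; apply: integral_ge0 => w _.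
  by rewrite lee_fin powR_ge0.
- rewrite in_itv/= leey andbT unlock; apply: integral_ge0 => w _.
  by rewrite lee_fin powR_ge0.
rewrite unlock; apply: ae_ge0_le_integral => //.
- exact: measurable_norm_powR.
- exact: measurable_norm_powR.
- by apply: filterS XY => w XYw _; rewrite lee_fin ge0_ler_powR ?nnegrE.
Qed.

Lemma normqD (X Y : Omega -> R) :
    measurable_fun setT X -> measurable_fun setT Y ->
  (normq (fun w => (X w + Y w)%R) <= normq X + normq Y)%E.
Proof. by move=> mX mY; exact: minkowski_EFin. Qed.

Lemma normqZ (c : R) (X : Omega -> R) : 0 <= c -> measurable_fun setT X ->
  normq (fun w => c * X w)%R = (c%:E * normq X)%E.
Proof.
move=> c0 mX; rewrite !normqE unlock.
under eq_integral do rewrite normrM (ger0_norm c0) powRM// EFinM.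
rewrite ge0_integralZl//; last 2 first.
- exact: measurable_norm_powR.
- by rewrite lee_fin powR_ge0.
rewrite poweRM ?lee_fin ?powR_ge0//; last first.
  by apply: integral_ge0 => w _; rewrite lee_fin powR_ge0.
by rewrite poweR_EFin -powRrM mulfV ?gt_eqF// powRr1.
Qed.

Lemma normq_cst (c : R) : 0 <= c -> normq (fun=> c) = c%:E.
Proof.
move=> c0; rewrite normqE unlock.
rewrite (integral_cst P measurableT (`|c| `^ q)%:E) /= probability_setT mule1.
by rewrite poweR_EFin -powRrM mulfV ?gt_eqF// powRr1// ger0_norm.
Qed.

End Norms.

Section IndependentNorms.
Context {d : measure_display} {Omega : measurableType d} {R : realType}.
Variables (P : probability Omega R) (q : R).
Hypothesis q_ge1 : 1 <= q.
Let q_gt0 : 0 < q. Proof. exact: lt_le_trans q_ge1. Qed.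

Lemma normqM_indep (G H : set (set Omega)) (X Y : Omega -> R) :
    G `<=` measurable -> H `<=` measurable -> independent_families P G H ->
    measurable_wrt G X -> measurable_wrt H Y ->
  normq P q (fun w => X w * Y w) = (normq P q X * normq P q Y)%E.
Proof.
move=> sG sH GH GX HY; rewrite !normqE unlock.
have mpow : measurable_fun setT (fun x : R => `|x| `^ q).
  by apply: (measurableT_comp (measurable_powR q)); exact: normr_measurable.
have wrt (K : set (set Omega)) (Z : Omega -> R) : measurable_wrt K Z ->
    measurable_wrt K (fun w => `|Z w| `^ q).
  move=> KZ B mB; have := KZ _ (mpow measurableT B mB).
  by rewrite setTI.
under eq_integral do rewrite normrM powRM//.
rewrite (expectationM_indep sG sH GH (wrt _ _ GX) (wrt _ _ HY)); last 2 first.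
- by move=> w; exact: powR_ge0.
- by move=> w; exact: powR_ge0.
by rewrite poweRM//; apply: integral_ge0 => w _; rewrite lee_fin powR_ge0.
Qed.

(** Interpolation from an integer exponent: with [y = s X], the bound
    [y^q <= 1 + y^k] needs no Jensen inequality. *)
Lemma normq_le_moment (X : Omega -> R) (k : nat) (C s : R) :
    measurable_fun setT X -> (forall w, 0 <= X w) -> q <= k%:R ->
    0 < s -> 0 <= C ->
    (\int[P]_w (X w ^+ k)%:E <= (C / s ^+ k)%:E)%E ->
  (normq P q X <= ((1 + C) `^ q^-1 / s)%:E)%E.
Proof.
move=> mX X0 qk s0 C0 hX; rewrite normqE unlock.
have C1 : 0 <= 1 + C by rewrite addr_ge0.
have bnd : (\int[P]_w (`|X w| `^ q)%:E <= ((1 + C) / s `^ q)%:E)%E.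
  apply: (@le_trans _ _ (\int[P]_w ((s `^ q)^-1%:E * (1 + s ^+ k * X w ^+ k)%:E))%E).
    apply: ge0_le_integral => //.
    - exact: measurable_norm_powR.
    - apply/measurable_EFinP; apply: measurable_funM => //.
      apply: measurable_funD => //; apply: measurable_funM => //.
      exact: measurable_funX.
    - move=> w _; rewrite -EFinM lee_fin (ger0_norm (X0 w)) mulrC ler_pdivlMr ?powR_gt0//.
      rewrite -powRM ?(ltW s0)// -exprMn mulrC.
      have y0 : 0 <= s * X w by rewrite mulr_ge0// ltW.
      set y := s * X w in y0 *.
      have [y1|y1] := leP y 1.
        apply: (@le_trans _ _ 1); last by rewrite lerDl exprn_ge0.
        rewrite (_ : 1 = 1 `^ q); last by rewrite powR1.
        by apply: ge0_ler_powR => //; rewrite ?nnegrE// ltW.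
      apply: (@le_trans _ _ (y ^+ k)); last by rewrite lerDr.
      by rewrite -powR_mulrn// ler_powR// ltW.
  rewrite ge0_integralZl//; last 3 first.
  - apply/measurable_EFinP.
    apply: measurable_funD => //; apply: measurable_funM => //.
    exact: measurable_funX.
  - by move=> w _; rewrite lee_fin addr_ge0// mulr_ge0// exprn_ge0// ltW.
  - by rewrite lee_fin invr_ge0 powR_ge0.
  rewrite mulrC EFinM lee_wpmul2l ?lee_fin ?invr_ge0 ?powR_ge0//.
  under eq_integral do rewrite EFinD EFinM.
  have sk0 : 0 < s ^+ k by exact: exprn_gt0.
  have mXk : measurable_fun setT (fun w => (X w ^+ k)%:E).
    by apply/measurable_EFinP; exact: measurable_funX.
  rewrite ge0_integralD//; last 2 first.
  - by move=> w _; rewrite -EFinM lee_fin mulr_ge0// ?exprn_ge0// ltW.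
  - by apply: measurable_funeM.
  rewrite (integral_cst P measurableT 1%E)/= probability_setT mule1 EFinD leeD2l//.
  rewrite ge0_integralZl//; last 2 first.
  - by move=> w _; rewrite lee_fin exprn_ge0.
  - by rewrite lee_fin ltW.
  apply: (@le_trans _ _ ((s ^+ k)%:E * (C / s ^+ k)%:E)%E).
    by rewrite lee_wpmul2l// lee_fin ltW.
  by rewrite -EFinM mulrCA mulfV ?gt_eqF// mulr1.
have {}bnd := gt0_ler_poweR (r := q^-1) _ _ _ bnd.
apply: (le_trans (bnd _ _ _)).
- by rewrite invr_ge0 ltW.
- rewrite in_itv/= leey andbT; apply: integral_ge0 => w _.
  by rewrite lee_fin powR_ge0.
- by rewrite in_itv/= leey andbT lee_fin divr_ge0// powR_ge0.
rewrite poweR_EFin lee_fin powRM ?invr_ge0 ?powR_ge0//.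
by rewrite -powRN -powRrM mulNr mulfV ?gt_eqF// powR_inv1// ltW.
Qed.

End IndependentNorms.

(** * Moments of discounted jumps *)

Section Moments.
Context {d : measure_display} {Omega : measurableType d} {R : realType}.
Context (P : probability Omega R).
Variables (F : R -> set (set Omega)) (p : hawkes_param R).
Variables (tau : nat -> Omega -> R) (l0 : Omega -> R).
Hypotheses (hp : positive_param p) (hsub : subcritical p).
Hypothesis hS : stationary_hawkes P F p tau l0.
Let hN := stationary_hawkes_hawkes hS.
Variable q : R.
Hypothesis q_ge1 : 1 <= q.
Let q_gt0 : 0 < q. Proof. exact: lt_le_trans q_ge1. Qed.

Let lam (t : R) (w : Omega) : R := intensity p (tau^~ w) (l0 w) t.

Lemma normq_intensity (t : R) : 0 <= t -> normq P q (lam t) = normq P q l0.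
Proof.
move=> t0; rewrite !normqE unlock; congr (_ `^ _)%E.
apply: (integral_intensity hS (f := fun x => (`|x| `^ q)%:E)) => //.
apply/measurable_EFinP; apply: (measurableT_comp (measurable_powR q)).
exact: normr_measurable.
Qed.

(** From [y <= e^y] with [y = c lambda_0 / q], an exponential moment controls
    the moment of order [q]. *)
Lemma normq_init_fin : exists2 L : R, 0 <= L & normq P q l0 = L%:E.
Proof.
have [c c0 hc] := exp_moment hp hsub hS.
have [xi0 _ _] := hp.
have fin : (\int[P]_w (`|l0 w| `^ q)%:E < +oo)%E.
  apply: (@le_lt_trans _ _ (\int[P]_w (((q / c) `^ q)%:E * (expR (c * l0 w))%:E))%E).
    apply: ae_ge0_le_integral => //.
    - by apply: measurable_norm_powR; exact: (measurable_initP hN).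
    - by move=> w _; rewrite -EFinM lee_fin mulr_ge0 ?powR_ge0 ?expR_ge0.
    - apply/measurable_EFinP; apply: measurable_funM => //.
      apply: measurableT_comp => //; apply: measurable_funM => //.
      exact: (measurable_initP hN).
    - apply: filterS (stationary_hawkes_init_ge hS) => w xil _.
      have l00 : 0 <= l0 w by rewrite (le_trans (ltW xi0)).
      rewrite -EFinM lee_fin ger0_norm//.
      have E : expR (c * l0 w) = expR (c / q * l0 w) `^ q.
        by rewrite -expRM; congr expR; field; rewrite gt_eqF.
      have e0 : 0 <= q / c by rewrite divr_ge0// ltW.
      have e1 : 0 <= q / c * expR (c / q * l0 w) by apply: mulr_ge0; rewrite ?expR_ge0.
      rewrite E -powRM ?expR_ge0//; apply: ge0_ler_powR; rewrite ?nnegrE//.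
        exact: ltW.
      apply: (@le_trans _ _ (q / c * (c / q * l0 w))).
        rewrite (_ : q / c * (c / q * l0 w) = l0 w)//.
        by field; rewrite !gt_eqF.
      rewrite ler_wpM2l//.
      by have := expR_ge1Dx (c / q * l0 w); lra.
  rewrite ge0_integralZl//; last 2 first.
  - apply/measurable_EFinP; apply: measurableT_comp => //.
    by apply: measurable_funM => //; exact: (measurable_initP hN).
  - by rewrite lee_fin powR_ge0.
  rewrite lte_mul_pinfty// lee_fin powR_ge0//.
exists (fine (normq P q l0)); first by rewrite fine_ge0// normq_ge0.
rewrite fineK// normqE unlock; apply: fin_num_poweR.
by rewrite ge0_fin_numE//; apply: integral_ge0 => w _; rewrite lee_fin powR_ge0.
Qed.

Variable gamma : R.
Hypothesis gamma_gt0 : 0 < gamma.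

(** A discounted sample of the intensity at the times [t, t - 1, ...]: it
    dominates the discounted jumps and is measurable with respect to the
    intensity alone. *)
Definition sampled_intensity (n : nat) (t : R) (w : Omega) : R :=
  \sum_(j < n.+1) expR (- gamma * j%:R) * lam (t - j%:R) w.

Lemma sampled_intensityS (n : nat) (t : R) (w : Omega) :
  sampled_intensity n.+1 t w
  = lam t w + expR (- gamma) * sampled_intensity n (t - 1) w.
Proof.
rewrite /sampled_intensity big_ord_recl mulr0 expR0 mul1r subr0; congr (_ + _).
rewrite mulr_sumr; apply: eq_bigr => j _ /=.
rewrite mulrA -expRD /bump/= add1n -natr1; congr (expR _ * lam _ w); lra.
Qed.

Lemma measurable_sampled_intensity (n : nat) (t : R) :
  measurable_fun setT (sampled_intensity n t).
Proof.
apply: measurable_sum => j; apply: measurable_funM => //.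
exact: (measurable_lam hS).
Qed.

(** Iterating the one-unit recursion for discounted jumps down to the first
    unit of time. *)
Lemma discounted_jumps_le_sampled (n : nat) (t : R) (w : Omega) :
    base_rate p <= l0 w -> n%:R <= t < n.+1%:R ->
  count_int (tau^~ w) `]0, t[ (fun u => expR (- gamma * (t - u)))
  <= expR (decay_rate p) / jump_size p * sampled_intensity n t w.
Proof.
have [xi0 al0 be0] := hp.
move=> xil; have hw := hawkes_path hN w.
have step s : 0 <= s ->
  count_int (tau^~ w) `]0, s[ (fun u => expR (- gamma * (s - u)))
    <= expR (decay_rate p) / jump_size p * lam s w + expR (- gamma)
       * count_int (tau^~ w) `]0, s - 1[ (fun u => expR (- gamma * (s - 1 - u))).
  exact: (discounted_jumps_le hw be0 xil (ltW al0) al0 (ltW xi0) (ltW gamma_gt0)).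
elim: n t => [|n IH] t /andP[nt tn].
  apply: (le_trans (step _ nt)).
  rewrite (@count_int_oo _ _ hw (t - 1) _ 0); last first.
    move=> i _; rewrite (le_trans _ (ltW (jump_path_gt0 hw i)))//; lra.
  rewrite big_ord0 mulr0 addr0 /sampled_intensity big_ord1.
  by rewrite mulr0 expR0 mul1r subr0.
have t0 : 0 <= t by rewrite (le_trans _ nt).
apply: (le_trans (step _ t0)); rewrite sampled_intensityS [leRHS]mulrDr lerD2l.
rewrite mulrCA ler_wpM2l ?expR_ge0//; apply: IH.
by rewrite lerBrDr ltrBlDr !natr1 nt tn.
Qed.

(** By stationarity all the terms have the same norm up to the geometric
    weights, so the bound depends neither on [n] nor on [t]. *)
Lemma normq_sampled_intensity (L : R) (n : nat) (t : R) :
    0 <= L -> normq P q l0 = L%:E -> n%:R <= t ->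
  (normq P q (sampled_intensity n t) <= (L / (1 - expR (- gamma)))%:E)%E.
Proof.
move=> L0 LE.
have g1 : 0 < 1 - expR (- gamma) by rewrite subr_gt0 expR_lt1 oppr_lt0.
elim: n t => [|n IH] t nt.
  rewrite (_ : sampled_intensity 0 t = lam t); last first.
    apply/funext => w.
    by rewrite /sampled_intensity big_ord1 mulr0 expR0 mul1r subr0.
  rewrite (normq_intensity nt) LE lee_fin ler_pdivlMr//.
  by rewrite ler_piMr// gerBl expR_ge0.
have t0 : 0 <= t by rewrite (le_trans _ nt).
rewrite (_ : sampled_intensity n.+1 t = fun w =>
    lam t w + expR (- gamma) * sampled_intensity n (t - 1) w); last first.
  by apply/funext => w; exact: sampled_intensityS.
apply: (@le_trans _ _ (normq P q (lam t)
    + normq P q (fun w => (expR (- gamma) * sampled_intensity n (t - 1) w)%R))%E).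
  apply: normqD => //; first exact: (measurable_lam hS).
  by apply: measurable_funM => //; exact: measurable_sampled_intensity.
rewrite normqZ ?expR_ge0//; last exact: measurable_sampled_intensity.
rewrite normq_intensity// LE.
apply: (@le_trans _ _ (L%:E + (expR (- gamma))%:E
    * (L / (1 - expR (- gamma)))%:E)%E).
  rewrite leeD2l// lee_wpmul2l ?lee_fin ?expR_ge0//; apply: IH.
  by rewrite lerBrDr natr1.
rewrite -EFinM -EFinD lee_fin le_eqVlt; apply/orP; left; apply/eqP.
by field; rewrite gt_eqF.
Qed.

End Moments.

(** * The plug-in error *)

Section PlugInError.
Context {R : realType}.

Lemma param_dist_ge (p q : hawkes_param R) :
  [/\ `|base_rate p - base_rate q| <= param_dist p q,
      `|jump_size p - jump_size q| <= param_dist p q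
    & `|decay_rate p - decay_rate q| <= param_dist p q].
Proof.
rewrite /param_dist; set a := base_rate p - _; set b := jump_size p - _.
set c := decay_rate p - _.
have [a0 b0 c0] : [/\ 0 <= a ^+ 2, 0 <= b ^+ 2 & 0 <= c ^+ 2].
  by split; exact: sqr_ge0.
by split; rewrite -sqrtr_sqr ler_wsqrtr//; lra.
Qed.

Variable eps : R.
Hypothesis eps_gt0 : 0 < eps.

(** The mean value theorem produces a factor [u e^{-eps u}]; half of the
    exponential absorbs [u]. *)
Lemma expR_rate_diff (x y u : R) : eps < x -> eps < y -> 0 <= u ->
  `|expR (- x * u) - expR (- y * u)|
  <= `|x - y| * (2 / eps) * expR (- (eps / 2) * u).
Proof.
wlog xy : x y / x <= y.
  move=> H ex ey u0; have [xy|yx] := leP x y; first exact: H.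
  by rewrite distrC (distrC x y) H// ltW.
move=> ex ey u0; rewrite (distrC x y) (@ger0_norm _ (y - x)) ?subr_ge0//.
have -> : - y * u = - x * u + - ((y - x) * u) by ring.
rewrite expRD -{1}[expR (- x * u)]mulr1 -mulrBr.
have h1 : 0 <= (y - x) * u by rewrite mulr_ge0// subr_ge0.
rewrite ger0_norm; last first.
  by rewrite mulr_ge0 ?expR_ge0// subr_ge0 expR_le1 oppr_le0.
apply: (@le_trans _ _ (expR (- eps * u) * ((y - x) * u))).
  apply: ler_pM; rewrite ?expR_ge0//.
  - by rewrite subr_ge0 expR_le1 oppr_le0.
  - by rewrite ler_expR !mulNr lerN2 ler_wpM2r// ltW.
  - by have := expR_ge1Dx (- ((y - x) * u)); lra.
have -> : - eps * u = - (eps / 2) * u + - (eps / 2) * u by field.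
rewrite expRD.
set e := expR (- (eps / 2) * u); have e0 : 0 < e by exact: expR_gt0.
have h2 : u * e <= 2 / eps.
  have := expR_ge1Dx (eps / 2 * u).
  rewrite (_ : expR (eps / 2 * u) = e^-1); last first.
    by rewrite /e mulNr expRN invrK.
  move=> h; have h' : eps / 2 * u <= e^-1 by lra.
  have h3 : eps / 2 * u * e <= 1 by rewrite -ler_pdivlMr// mul1r.
  rewrite ler_pdivlMr//; lra.
have h3 : 0 <= (y - x) * e by rewrite mulr_ge0 ?subr_ge0// ltW.
have := ler_wpM2l h3 h2; lra.
Qed.

Variables (p ph : hawkes_param R) (T : nat -> R) (l0 l' : R).
Hypotheses (hp : positive_param p) (hT : jump_path T) (l0_ge : base_rate p <= l0).
Hypotheses (eps_p : eps < decay_rate p) (eps_ph : eps < decay_rate ph).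

(** Only the error on the initial intensity survives with the constant one:
    every other term carries an error on a parameter. *)
Lemma plug_in_error (t : R) : 0 <= t ->
  `|intensity ph T l' t - intensity p T l0 t|
  <= `|l0 - l'| * expR (- eps * t)
     + param_dist ph p * (1 + 2 / eps * l0 + (1 + 2 / eps * jump_size p)
         * count_int T `]0, t[ (fun u => expR (- (eps / 2) * (t - u)))).
Proof.
move=> t0; have [xi0 al0 be0] := hp.
have half : eps / 2 <= eps by have := eps_gt0; lra.
have [n Hn] := jumps_lt hT t.
have Ht i : (n <= i)%N -> t <= T i by rewrite leqNgt leNgt Hn.
have sumE (f : R -> R) : count_int T `]0, t[ f = \sum_(i < n) f (T i).
  rewrite (count_int_oo hT _ Ht); apply: eq_bigr => i _.
  by rewrite Hn ltn_ord.
have [dxi dal dbe] := param_dist_ge ph p.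
set D := param_dist ph p in dxi dal dbe *.
have D0 : 0 <= D by rewrite (le_trans _ dxi).
have e2 : 0 <= 2 / eps by rewrite divr_ge0// ltW.
rewrite /intensity !sumE.
set eh := expR (- decay_rate ph * t); set e := expR (- decay_rate p * t).
set S1 := \sum_(i < n) _; set S2 := \sum_(i < n) _; set Y := \sum_(i < n) _.
have -> : base_rate ph + (l' - base_rate ph) * eh + S1
    - (base_rate p + (l0 - base_rate p) * e + S2)
  = (l' - l0) * eh + (base_rate ph - base_rate p) * (1 - eh)
    + (l0 - base_rate p) * (eh - e) + (S1 - S2) by ring.
have eh0 : 0 <= eh by exact: expR_ge0.
have eh1 : eh <= expR (- eps * t).
  by rewrite ler_expR !mulNr lerN2 ler_wpM2r// ltW.
have eh2 : eh <= 1.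
  by rewrite expR_le1 mulNr oppr_le0 mulr_ge0// ltW// (lt_trans eps_gt0).
have b1 : `|(l' - l0) * eh| <= `|l0 - l'| * expR (- eps * t).
  by rewrite normrM distrC (ger0_norm eh0) ler_wpM2l.
have b2 : `|(base_rate ph - base_rate p) * (1 - eh)| <= D.
  rewrite normrM -[leRHS]mulr1 ler_pM// ger0_norm; lra.
have b3 : `|(l0 - base_rate p) * (eh - e)| <= D * (2 / eps * l0).
  rewrite normrM ger0_norm ?subr_ge0//.
  have h := expR_rate_diff eps_ph eps_p t0.
  have h1 : `|decay_rate ph - decay_rate p| * (2 / eps) * expR (- (eps / 2) * t)
      <= D * (2 / eps).
    rewrite -[leRHS]mulr1; apply: ler_pM; rewrite ?expR_ge0//.
    - by rewrite mulr_ge0.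
    - by rewrite ler_wpM2r.
    - by rewrite expR_le1 mulNr oppr_le0 mulr_ge0// divr_ge0// ltW.
  have h2 : `|eh - e| <= D * (2 / eps) by exact: le_trans h h1.
  rewrite (_ : D * (2 / eps * l0) = l0 * (D * (2 / eps))); last by ring.
  by apply: ler_pM; rewrite ?subr_ge0// gerBl ltW.
have b4 : `|S1 - S2| <= D * ((1 + 2 / eps * jump_size p) * Y).
  rewrite -sumrB mulr_sumr mulr_sumr; apply: (le_trans (ler_norm_sum _ _ _)).
  apply: ler_sum => i _; have u0 : 0 <= t - T i.
    by rewrite subr_ge0 ltW// Hn.
  set u := t - T i in u0 *.
  have -> : jump_size ph * expR (- decay_rate ph * u)
      - jump_size p * expR (- decay_rate p * u)
    = (jump_size ph - jump_size p) * expR (- decay_rate ph * u)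
      + jump_size p * (expR (- decay_rate ph * u) - expR (- decay_rate p * u)).
    by ring.
  apply: (le_trans (ler_normD _ _)).
  set z := expR (- (eps / 2) * u).
  have z0 : 0 <= z by exact: expR_ge0.
  have h1 : `|(jump_size ph - jump_size p) * expR (- decay_rate ph * u)| <= D * z.
    rewrite normrM ler_pM// ger0_norm ?expR_ge0// ler_expR !mulNr lerN2.
    by rewrite ler_wpM2r// (le_trans half (ltW eps_ph)).
  have h := expR_rate_diff eps_ph eps_p u0.
  have h2 : `|jump_size p * (expR (- decay_rate ph * u) - expR (- decay_rate p * u))|
      <= jump_size p * (D * (2 / eps) * z).
    rewrite normrM gtr0_norm// ler_pM2l//; apply: (le_trans h).
    by rewrite ler_wpM2r// ler_wpM2r.
  by apply: (le_trans (lerD h1 h2)); rewrite le_eqVlt; apply/orP; left;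
    apply/eqP; ring.
rewrite (_ : _ + D * _ = `|l0 - l'| * expR (- eps * t) + D
    + D * (2 / eps * l0) + D * ((1 + 2 / eps * jump_size p) * Y)); last by ring.
by do 3 (apply: (le_trans (ler_normD _ _)); apply: lerD => //).
Qed.

End PlugInError.

Section HawkesSigma.
Context {d : measure_display} {Omega : measurableType d} {R : realType}.
Context (P : probability Omega R).
Variables (F : R -> set (set Omega)) (p : hawkes_param R).
Variables (tau : nat -> Omega -> R) (l0 : Omega -> R).
Hypothesis hS : stationary_hawkes P F p tau l0.

Lemma hawkes_sigma_algebra (D : set R) :
  sigma_algebra setT (hawkes_sigma D p tau l0).
Proof. exact: smallest_sigma_algebra. Qed.

Lemma hawkes_sigma_measurable :
  hawkes_sigma [set s | 0 <= s] p tau l0 `<=` measurable.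
Proof.
apply: smallest_sub; first exact: sigma_algebra_measurable.
have hN := stationary_hawkes_hawkes hS.
move=> A [t /= t0 [|] [B mB <-]].
  exact: (measurable_countingP hN).
exact: (measurable_lam hS).
Qed.

Lemma hawkes_sigma_sub (D E : set R) : D `<=` E ->
  hawkes_sigma D p tau l0 `<=` hawkes_sigma E p tau l0.
Proof. by move=> DE; apply: sub_sigma_algebra2; exact: bigcup_subset. Qed.

Lemma intensity_hawkes_sigma (D : set R) (t : R) : D t ->
  measurable_wrt (hawkes_sigma D p tau l0)
    (fun w => intensity p (tau^~ w) (l0 w) t).
Proof.
move=> Dt B mB; apply: sub_sigma_algebra; exists t => //; right.
by exists B => //; rewrite setTI.
Qed.

End HawkesSigma.

Theorem theorem4p1 (d : measure_display) (Omega : measurableType d)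
  (R : realType) (P : probability Omega R)
  (theta : hawkes_param R)
  (theta_pos : positive_param theta) (theta_sub : subcritical theta)
  (* the stationary Hawkes process N and its intensity *)
  (F : R -> set (set Omega)) (tau : nat -> Omega -> R) (lambda0 : Omega -> R)
  (hN : stationary_hawkes P F theta tau lambda0)
  (* the second dataset, independent of N and of its intensity *)
  (F' : R -> set (set Omega)) (tau' : nat -> Omega -> R)
  (lambda0' : Omega -> R)
  (hN' : stationary_hawkes P F' theta tau' lambda0')
  (hindep : independent_families P
     (hawkes_sigma [set s | 0 <= s] theta tau lambda0)
     (hawkes_sigma [set s | 0 <= s] theta tau' lambda0'))
  (* the maximum likelihood estimator computed from the second dataset *)
  (Theta : set (hawkes_param R))
  (hTheta : Theta theta) (hTheta_pos : Theta `<=` positive_param)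
  (init : hawkes_param R -> Omega -> R)
  (hinit : forall p w, Theta p -> 0 <= init p w)
  (thetahat : R -> Omega -> hawkes_param R)
  (hthetahat_meas : forall T : R, 0 < T -> param_measurable_wrt
     (hawkes_sigma [set s | 0 <= s <= T] theta tau' lambda0') (thetahat T))
  (hthetahat_mle : forall T : R, 0 < T ->
     is_mle P Theta init tau' T (thetahat T))
  (hthetahat_moments : forall k : nat, (1 <= k)%N ->
     exists2 C : R, 0 < C & forall T : R, 0 < T ->
       ('E_P[(fun w => param_dist (thetahat T w) theta ^+ k)%R]
        <= (C * T `^ (- (k%:R / 2)))%:E)%E)
  (* the approximation of the initial intensity *)
  (lambdatilde0 : R -> {RV P >-> R})
  (epsilon : R) (heps : 0 < epsilon < 1)
  (hbeta : epsilon < decay_rate theta)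
  (hbetahat : forall T : R, 0 < T ->
     {ae P, forall w, epsilon < decay_rate (thetahat T w)}) :
  forall q : R, 2 <= q ->
  exists2 C : R, 0 < C & forall T t : R, 0 < T -> 0 <= t <= T ->
    ('E_P[(fun w => `| intensity (thetahat T w) (tau^~ w) (lambdatilde0 T w) t
                       - intensity theta (tau^~ w) (lambda0 w) t | `^ q)%R]
       `^ q^-1
     <= (C / Num.sqrt T)%:E
        + 'E_P[(fun w => `| lambda0 w - lambdatilde0 T w | `^ q)%R] `^ q^-1
          * (expR (- epsilon * t))%:E)%E.
Proof.
move=> q q_ge2.
have q_ge1 : 1 <= q by rewrite (le_trans _ q_ge2)// ler1n.
have q_gt0 : 0 < q by exact: lt_le_trans q_ge1.
have [xi0 al0 be0] := theta_pos.
have /andP[eps0 eps1] := heps.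
have hNN := stationary_hawkes_hawkes hN.
pose k := (Num.truncn q).+1.
have qk : q <= k%:R by exact: ltW (truncnS_gt q).
have [Ck Ck0 hCk] := hthetahat_moments k isT.
have [L L0 LE] := normq_init_fin theta_pos theta_sub hN q_ge1.
pose gam := epsilon / 2.
have gam0 : 0 < gam by rewrite divr_gt0.
have g1 : 0 < 1 - expR (- gam) by rewrite subr_gt0 expR_lt1 oppr_lt0.
pose C1 := (1 + 2 / epsilon * jump_size theta)
           * (expR (decay_rate theta) / jump_size theta).
have e2 : 0 <= 2 / epsilon by rewrite divr_ge0// ltW.
have C10 : 0 <= C1.
  rewrite mulr_ge0 ?addr_ge0 ?mulr_ge0 ?expR_ge0 ?invr_ge0//; exact: ltW.
pose Bq := 1 + (2 / epsilon * L + C1 * (L / (1 - expR (- gam)))).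
have Bq0 : 0 < Bq.
  rewrite ltr_wpDr// addr_ge0// mulr_ge0// divr_ge0// ltW//.
have CkP : 0 < (1 + Ck) `^ q^-1 by rewrite powR_gt0// addr_gt0.
exists ((1 + Ck) `^ q^-1 * Bq); first exact: mulr_gt0.
move=> T t T0 /andP[t0 tT].
pose n := Num.truncn t.
have nt : n%:R <= t < n.+1%:R by exact: truncn_itv.
pose lam s w := intensity theta (tau^~ w) (lambda0 w) s.
(* The factor of the parameter error, bounded by values of the intensity only,
   hence independent of the second dataset. *)
pose Q w := 1 + (2 / epsilon * lambda0 w
                 + C1 * sampled_intensity theta tau lambda0 gam n t w).
pose dist w := param_dist (thetahat T w) theta.
pose Delta w := intensity (thetahat T w) (tau^~ w) (lambdatilde0 T w) t
                - intensity theta (tau^~ w) (lambda0 w) t.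
pose init_err w := lambda0 w - lambdatilde0 T w.
have sG := hawkes_sigma_measurable hN.
have sG' := hawkes_sigma_measurable hN'.
have alg' := hawkes_sigma_algebra theta tau' lambda0' [set s | 0 <= s].
have alg := hawkes_sigma_algebra theta tau lambda0 [set s | 0 <= s].
have hat (f : hawkes_param R -> R) :
    measurable_wrt (hawkes_sigma [set s | 0 <= s <= T] theta tau' lambda0')
      (fun w => f (thetahat T w)) ->
    measurable_wrt (hawkes_sigma [set s | 0 <= s] theta tau' lambda0')
      (fun w => f (thetahat T w)).
  move=> h B mB; apply: (hawkes_sigma_sub (D := [set s | 0 <= s <= T])).
    by move=> s /= /andP[].
  exact: h.
have [/hat wb /hat wj /hat wd] := hthetahat_meas T T0.
have wdist : measurable_wrt (hawkes_sigma [set s | 0 <= s] theta tau' lambda0') dist.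
  apply/(measurable_wrtP alg').
  move/(measurable_wrtP alg') in wb; move/(measurable_wrtP alg') in wj.
  move/(measurable_wrtP alg') in wd.
  apply: measurableT_comp.
    by apply: continuous_measurable_fun; exact: sqrt_continuous.
  apply: measurable_funD; [apply: measurable_funD|];
    by apply: measurable_funX; exact: measurable_funB.
have wQ : measurable_wrt (hawkes_sigma [set s | 0 <= s] theta tau lambda0) Q.
  apply/(measurable_wrtP alg).
  have mlam s : 0 <= s -> measurable_fun setT
      (lam s : g_sigma_algebraType (hawkes_sigma [set s | 0 <= s] theta tau lambda0) -> R).
    by move=> s0; apply/(measurable_wrtP alg); exact: intensity_hawkes_sigma.
  have ml0 : measurable_fun setT
      (lambda0 : g_sigma_algebraType (hawkes_sigma [set s | 0 <= s] theta tau lambda0) -> R).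
    have lam0 : lam 0 = lambda0 by apply/funext => w; exact: (intensity0 hN).
    by have := mlam 0 (lexx 0); rewrite lam0.
  apply: measurable_funD => //; apply: measurable_funD; first exact: measurable_funM.
  apply: measurable_funM => //; apply: measurable_sum => j.
  apply: measurable_funM => //; apply: mlam.
  rewrite subr_ge0 (le_trans _ (proj1 (andP nt)))// ler_nat.
  by rewrite -ltnS.
have mdist := measurable_wrt_fun sG' wdist.
have mQ := measurable_wrt_fun sG wQ.
have ml0 : measurable_fun setT lambda0 by exact: (measurable_initP hNN).
have mlt : measurable_fun setT (lambdatilde0 T) by exact: measurable_funP.
have merr : measurable_fun setT init_err by exact: measurable_funB.
have mDelta : measurable_fun setT Delta.
  apply: measurable_funB; last exact: (measurable_lam hN).
  by apply: (measurable_intensity hNN) => //; exact: (measurable_wrt_fun sG').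
have e0 : 0 <= expR (- epsilon * t) by exact: expR_ge0.
have normQ : (normq P q Q <= Bq%:E)%E.
  have mV := measurable_sampled_intensity hN gam n t.
  set V := sampled_intensity _ _ _ _ _ _ in mV.
  have m1 : measurable_fun setT (fun w => 2 / epsilon * lambda0 w).
    exact: measurable_funM.
  have m2 : measurable_fun setT (fun w => C1 * V w) by exact: measurable_funM.
  have m12 := measurable_funD m1 m2.
  have m0 : measurable_fun [set: Omega] (fun=> 1 : R) by exact: measurable_cst.
  apply: (le_trans (normqD P q_ge1 m0 m12)).
  rewrite normq_cst// [leRHS]EFinD leeD2l//.
  apply: (le_trans (normqD P q_ge1 m1 m2)).
  rewrite !normqZ// LE [leRHS]EFinD; apply: leeD; first by rewrite EFinM.
  rewrite [leRHS]EFinM; apply: lee_wpmul2l; first by rewrite lee_fin.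
  exact: (normq_sampled_intensity hN q_ge1 gam0 L0 LE (proj1 (andP nt))).
have normdist : (normq P q dist <= ((1 + Ck) `^ q^-1 / Num.sqrt T)%:E)%E.
  apply: (normq_le_moment q_ge1 (k := k)) => //.
  - by move=> w; exact: sqrtr_ge0.
  - by rewrite sqrtr_gt0.
  - exact: ltW.
  - have := hCk T T0; rewrite unlock => /le_trans; apply.
    rewrite lee_fin -(powR12_sqrt (ltW T0)) -powR_mulrn ?powR_ge0// -powRrM -powRN.
    by rewrite (mulrC k%:R).
have normDQ : (normq P q (fun w => dist w * Q w)%R
    <= ((1 + Ck) `^ q^-1 * Bq / Num.sqrt T)%:E)%E.
  have hindep' : independent_families P
      (hawkes_sigma [set s | 0 <= s] theta tau' lambda0')
      (hawkes_sigma [set s | 0 <= s] theta tau lambda0).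
    by move=> A B hA hB; rewrite setIC hindep// muleC.
  rewrite (normqM_indep q sG' sG hindep' wdist wQ).
  rewrite mulrAC EFinM; apply: lee_pmul => //; exact: normq_ge0.
rewrite -[leLHS](normqE P q Delta) -(normqE P q init_err).
apply: (@le_trans _ _ (normq P q (fun w => expR (- epsilon * t) * `|init_err w|)%R
    + normq P q (fun w => `|dist w * Q w|)%R)%E).
  apply: le_trans (normqD P q_ge1 _ _).
  - apply: le_normq => //.
      apply: measurable_funD.
        by apply: measurable_funM => //; exact: measurableT_comp.
      by apply: measurableT_comp => //; exact: measurable_funM.
    have := hbetahat T T0; have := stationary_hawkes_init_ge hN.
    apply: filterS2 => w xil epsw.
    have perr := plug_in_error eps0 (lambdatilde0 T w) theta_pos
      (hawkes_path hNN w) xil hbeta epsw t0.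
    rewrite [leRHS]ger0_norm ?addr_ge0// ?mulr_ge0//.
    apply: (le_trans perr); rewrite mulrC lerD2l.
    apply: le_trans (ler_norm _); rewrite /dist ler_wpM2l ?sqrtr_ge0//.
    rewrite /Q -addrA lerD2l lerD2l /C1 -[leRHS]mulrA ler_wpM2l//.
      by rewrite addr_ge0// mulr_ge0// ltW.
    exact: (discounted_jumps_le_sampled theta_pos hN gam0 xil nt).
  - by apply: measurable_funM => //; exact: measurableT_comp.
  - by apply: measurableT_comp => //; exact: measurable_funM.
have norm_abs (X : Omega -> R) : normq P q (fun w => `|X w|) = normq P q X.
  by rewrite !normqE; under eq_fun do rewrite normr_id.
rewrite normqZ//; last exact: measurableT_comp.
by rewrite !norm_abs addeC muleC leeD2r.
Qed.
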